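(* Every coplactic Lie element lies in the Solomon descent algebra: $\mathsf{Lie}\cap\mathcal{Q}\subseteq\mathcal{D}$, as subsets of $\mathcal{P}=\bigoplus_{n\ge0}\mathbb{Z}\mathcal{S}_n$.
   Context: For $n\ge 0$ let $\mathcal{S}_n$ be the symmetric group on $\{1,\dots,n\}$. Permutations act on the right (the image of $i$ under $\pi$ is written $i\pi$), products are read from left to right, so $i(\sigma\nu)=(i\sigma)\nu$, and $\pi\in\mathcal{S}_n$ is identified with the word $(1\pi)(2\pi)\cdots(n\pi)$. $\mathcal{D}$ is the $\mathbb{Z}$-linear span in $\mathcal{P}$ of the sums $\sum_{\pi\in\mathcal{S}_n,\,\mathrm{Des}(\pi)=D}\pi$, for $n\ge0$ and $D\subseteq\{1,\dots,n-1\}$, where $\mathrm{Des}(\pi)=\{i\in\{1,\dots,n-1\}\mid i\pi>(i+1)\pi\}$. $\mathcal{Q}$ is the $\mathbb{Z}$-linear span of the sums $\sum_{\sigma\in\mathcal{S}_n,\,Q(\sigma)=Q(\pi)}\sigma$, for $n\ge0$ and $\pi\in\mathcal{S}_n$, where $Q(\pi)$ is the Schensted $Q$-symbol of $\pi$, i.e. the recording tableau obtained by Schensted row insertion of the word $(1\pi)\cdots(n\pi)$. (Elements of $\mathcal{Q}$ are called coplactic.) For $n\ge1$ let $\omega_n=\sum_\pi(-1)^{1\pi^{-1}-1}\pi\in\mathbb{Z}\mathcal{S}_n$, the sum over all valley permutations $\pi\in\mathcal{S}_n$, i.e. those with $1\pi>\cdots>(k-1)\pi>k\pi<(k+1)\pi<\cdots<n\pi$,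 where $k=1\pi^{-1}$. Put $\mathsf{Lie}_n=\omega_n\mathbb{Z}\mathcal{S}_n$ (product in the group algebra, read left to right) and $\mathsf{Lie}_0=0$, and $\mathsf{Lie}=\bigoplus_{n\ge0}\mathsf{Lie}_n$. *)

(* Defs.v *)
From mathcomp Require Import all_boot all_order all_algebra all_fingroup.
From mathcomp Require Export monalg.

Set Implicit Arguments.
Unset Strict Implicit.
Unset Printing Implicit Defensive.

Import GRing.Theory.
Local Open Scope ring_scope.

(* Letters and positions are counted from 0: 'I_n stands for {1,..,n}.        *)

Definition word n (pi : 'S_n) : seq nat := [seq val (pi i) | i <- enum 'I_n].

(* The direct sum of all ZS_n, as the free Z-module on the disjoint union of  *)
(* all the symmetric groups.                                                  *)
Notation perms := {n : nat & 'S_n}.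

Definition Perm n (pi : 'S_n) : perms := Tagged (fun n => 'S_n) pi.

Notation PZ := {malg int[perms]}.

Definition component n (x : PZ) : {ffun 'S_n -> int} :=
  [ffun pi => x@_(Perm pi)].

Definition int_span (V : zmodType) (G : V -> Prop) (v : V) : Prop :=
  exists m (X : m.-tuple V), (forall i, G (tnth X i)) /\ inIntSpan X v.

(* Position i < n.-1 stands for the descent position i.+1 of {1,..,n-1}.      *)
Definition Des n (pi : 'S_n) : {set 'I_n.-1} :=
  [set i : 'I_n.-1 | (nth 0 (word pi) i > nth 0 (word pi) i.+1)%N].

Definition descent_sum n (D : {set 'I_n.-1}) : PZ :=
  \sum_(pi : 'S_n | Des pi == D) << Perm pi >>.

Definition in_descent_algebra : PZ -> Prop :=
  int_span (fun x => exists n (D : {set 'I_n.-1}), x = descent_sum D).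

(* Insert x into the tableau t (the sequence of its rows, from the longest):  *)
(* the new tableau, and the index of the row that acquires a new cell.        *)
Fixpoint row_insert (t : seq (seq nat)) (x : nat) : seq (seq nat) * nat :=
  if t is r :: t' then
    let j := find (fun y => x < y)%N r in
    if (j < size r)%N then
      let: (t'', k) := row_insert t' (nth 0%N r j) in
      (set_nth 0%N r j x :: t'', k.+1)
    else (rcons r x :: t', 0%N)
  else ([:: [:: x]], 0%N).

Definition add_cell (q : seq (seq nat)) (k l : nat) : seq (seq nat) :=
  set_nth [::] q k (rcons (nth [::] q k) l).

Definition schensted_step (pq : seq (seq nat) * seq (seq nat))
    (lx : nat * nat) : seq (seq nat) * seq (seq nat) :=
  let: (p, k) := row_insert pq.1 lx.2 in (p, add_cell pq.2 k lx.1).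

Definition schensted (w : seq nat) : seq (seq nat) * seq (seq nat) :=
  foldl schensted_step ([::], [::]) (zip (iota 1 (size w)) w).

Definition Qsymbol n (pi : 'S_n) : seq (seq nat) := (schensted (word pi)).2.

Definition coplactic_sum n (pi : 'S_n) : PZ :=
  \sum_(sigma : 'S_n | Qsymbol sigma == Qsymbol pi) << Perm sigma >>.

Definition coplactic : PZ -> Prop :=
  int_span (fun x => exists n (pi : 'S_n), x = coplactic_sum pi).

(* The product of 'S_n in the library is read from left to right:             *)
(* (s * t) i = t (s i).                                                       *)
Definition gmul n (f g : {ffun 'S_n -> int}) : {ffun 'S_n -> int} :=
  [ffun pi => \sum_(s : 'S_n) \sum_(t : 'S_n | (s * t)%g == pi) f s * g t].

(* The position of the least letter; it is k - 1 for k counted from 1.        *)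
Definition valley_pos n (pi : 'S_n.+1) : 'I_n.+1 := (pi^-1)%g ord0.

Definition valley n (pi : 'S_n.+1) : bool :=
  sorted gtn (take (valley_pos pi).+1 (word pi))
  && sorted ltn (drop (valley_pos pi) (word pi)).

Definition omega n : {ffun 'S_n.+1 -> int} :=
  [ffun pi => if valley pi then (-1) ^+ valley_pos pi else 0].

Definition in_Lie_n n : {ffun 'S_n -> int} -> Prop :=
  match n with
  | 0 => fun f => f = 0
  | m.+1 => fun f => exists g : {ffun 'S_m.+1 -> int}, f = gmul (omega m) g
  end.

(* An element of the direct sum of the Lie_n is an element of PZ all of whose *)
(* homogeneous components are Lie elements.                                   *)
Definition in_Lie (x : PZ) : Prop := forall n, in_Lie_n (component n x).

(* Main.v *)
Require Import Defs.
From mathcomp Require Import all_boot all_order all_algebra all_fingroup.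
From mathcomp Require Import finmap zify.

Set Implicit Arguments.
Unset Strict Implicit.
Unset Printing Implicit Defensive.

Import GRing.Theory.

(* A Lie element f, seen as a function on words, sums to zero over the proper
   shuffles of two words; a coplactic f takes the same value on two words that
   differ by an exchange of the letters i and i+1, if i-1 or i+2 stands between
   them. Together these say that the sum of f over the shuffles of r and q does
   not change when i and i+1 are exchanged in r and q, if i-1 or i+2 stands
   between them in [rev r ++ q]. This property passes to f(c :: _) for the least
   and for the greatest letter c, so by induction f(c :: y) = k_c(des y) for
   these two c. It remains to see that f(s :: l :: y) = k_lo(des(l :: y)) for
   s < l, the case s > l being symmetric. The difference G of both sides is
   again invariant under the exchanges, satisfies the shuffle relations below a
   root letter, and vanishes on words beginning with the least letter; induction
   on s shows that it vanishes on all words beginning with an ascent. *)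

(** * Shuffles *)

(** The reversed word comes from an identity of Lie elements: up to sign, f(rev r ++ c :: q) is the
    sum of f(c :: z) over the shuffles z of r and q. Below a root c the sums no longer vanish, so
    that only their invariance can be inherited, and [rev r ++ c :: q] is the word in which the
    exchange has to be allowed. Deleting the first letter leaves an interval of letters only if that
    letter is extreme; after an inner letter c the values c-1 and c+1 become neighbours without
    being exchangeable. Hence words beginning with an inner letter need an argument of their own.
    The function k_lo can be subtracted because any function of the descents satisfies the relations
    below a root when i and i+1 lie in different factors: the shuffles in which they are adjacent
    come in pairs. *)

Section Shuffle.

Context {T : eqType}.
Implicit Types (x y : T) (r q z : seq T).

(** Shuffles are listed with multiplicity, once for each way of interleaving. The inner fixpoint is
    there because each step shortens one word or the other. *)
Fixpoint shuf r q : seq (seq T) :=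
  if r is x :: r' then
    (fix shufr q := if q is y :: q' then
       map (cons x) (shuf r' (y :: q')) ++ map (cons y) (shufr q')
     else [:: r]) q
  else [:: q].

Lemma shufr0 r : shuf r [::] = [:: r].
Proof. by case: r. Qed.

Lemma shuf_cons x r y q :
  shuf (x :: r) (y :: q) =
  map (cons x) (shuf r (y :: q)) ++ map (cons y) (shuf (x :: r) q).
Proof. by []. Qed.

Lemma big_shuf_cons (V : nmodType) (F : seq T -> V) x r y q :
  (\sum_(z <- shuf (x :: r) (y :: q)) F z =
  \sum_(z <- shuf r (y :: q)) F (x :: z) +
  \sum_(z <- shuf (x :: r) q) F (y :: z))%R.
Proof. by rewrite shuf_cons big_cat /= !big_map. Qed.

Lemma shuf_ind (P : seq T -> seq T -> seq T -> Prop) :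
  (forall q, P [::] q q) -> (forall r, P r [::] r) ->
  (forall x r y q z, z \in shuf r (y :: q) -> P r (y :: q) z ->
     P (x :: r) (y :: q) (x :: z)) ->
  (forall x r y q z, z \in shuf (x :: r) q -> P (x :: r) q z ->
     P (x :: r) (y :: q) (y :: z)) ->
  forall r q z, z \in shuf r q -> P r q z.
Proof.
move=> P0l P0r Pl Pr; elim=> [q z|x r IHr].
  by rewrite inE => /eqP->.
elim=> [z|y q IHq z]; first by rewrite shufr0 inE => /eqP->.
rewrite shuf_cons mem_cat => /orP[] /mapP[z' z'P ->].
  by apply: Pl => //; apply: IHr.
by apply: Pr => //; apply: IHq.
Qed.

Lemma shuf_perm r q z : z \in shuf r q -> perm_eq z (r ++ q).
Proof.
move: r q z; apply: shuf_ind => [q|r|x r y q z _ zP|x r y q z _ zP] //=.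
- by rewrite cats0.
- by rewrite perm_cons.
- by rewrite perm_sym (perm_catCA (x :: r) [:: y] q) /= perm_cons perm_sym.
Qed.

Lemma shuf_subseql r q z : z \in shuf r q -> subseq r z.
Proof.
move: r q z; apply: shuf_ind => [q|r|x r y q z _ zP|x r y q z _ zP].
- exact: sub0seq.
- exact: subseq_refl.
- by rewrite /= eqxx.
- exact: subseq_trans zP (subseq_cons _ _).
Qed.

Lemma shuf_subseqr r q z : z \in shuf r q -> subseq q z.
Proof.
move: r q z; apply: shuf_ind => [q|r|x r y q z _ zP|x r y q z _ zP].
- exact: subseq_refl.
- exact: sub0seq.
- exact: subseq_trans zP (subseq_cons _ _).
- by rewrite /= eqxx.
Qed.

Lemma shuf_uniq r q : uniq (r ++ q) -> uniq (shuf r q).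
Proof.
elim: r q => [|x r IHr] //; elim=> [|y q IHq] // u.
rewrite shuf_cons cat_uniq !map_inj_uniq; try by move=> ? ? [].
have u' : uniq (y :: (x :: r) ++ q).
  by rewrite -(perm_uniq (permEl (perm_catCA (x :: r) [:: y] q))).
rewrite IHr; last by case/andP: u.
rewrite IHq ?andbT; last by case/andP: u'.
apply/hasPn => _ /mapP[z _ ->]; apply/mapP=> -[z' _ [/eqP]].
by case/andP: u' => /norP[/negPf->].
Qed.

(** A shuffle is cut at the first letter of the left word: only letters of [q] precede it. *)
Lemma shuf_split b r q z : z \in shuf (b :: r) q ->
  exists q1 q2 z', [/\ q = q1 ++ q2, z = q1 ++ b :: z' & z' \in shuf r q2].
Proof.
elim: q z => [|y q IHq] z.
  by rewrite shufr0 inE => /eqP->; exists [::], [::], r; rewrite shufr0 inE.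
rewrite shuf_cons mem_cat => /orP[] /mapP[z' z'P ->].
  by exists [::], (y :: q), z'.
have [q1 [q2 [z2 [-> -> z2P]]]] := IHq _ z'P.
by exists (y :: q1), q2, z2.
Qed.

Lemma mem_shuf_cat q1 b r q2 z : z \in shuf r q2 ->
  q1 ++ b :: z \in shuf (b :: r) (q1 ++ q2).
Proof.
move=> zP; elim: q1 => [|y q1 IHq1]; last first.
  by rewrite !cat_cons shuf_cons mem_cat; apply/orP; right; apply: map_f.
case: q2 zP => [|y q2] zP; first by move: zP; rewrite !shufr0 !inE => /eqP->.
by rewrite !cat0s shuf_cons mem_cat; apply/orP; left; apply: map_f.
Qed.

Lemma mem_shuf0 r q : r ++ q \in shuf r q.
Proof.
elim: r q => [|x r IHr] q; first by rewrite inE.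
case: q => [|y q]; first by rewrite shufr0 cats0 inE.
by rewrite shuf_cons mem_cat; apply/orP; left; apply: map_f.
Qed.

Lemma subseq_index z q x y : uniq z -> subseq q z -> y \in q ->
  index x q < index y q -> index x z < index y z.
Proof.
elim: z q => [|c z IHz] q; first by move=> _ /eqP->.
move=> /= /andP[cz uz]; case: q => [|d q] //=.
case: (eqVneq d c) => [->|dc] sq.
  rewrite inE; case: (eqVneq c x) => [_|cx]; first by move=> _; case: (c == y).
  rewrite [y == c]eq_sym; case: (eqVneq c y) => [//|cy] /= yq.
  by rewrite !ltnS => /(IHz _ uz sq yq).
move=> yq lt; have lt' := IHz _ uz sq yq lt.
have xq : x \in d :: q.
  by rewrite -index_mem; apply: leq_trans lt _; apply: (index_size y (d :: q)).
have [xz yz] : x \in z /\ y \in z by split; apply: (mem_subseq sq).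
have -> : (c == x) = false by apply: contraNF cz => /eqP->.
by have -> : (c == y) = false by apply: contraNF cz => /eqP->.
Qed.

End Shuffle.

Lemma shuf_map (T T' : eqType) (f : T -> T') r q :
  shuf (map f r) (map f q) = map (map f) (shuf r q).
Proof.
elim: r q => [|x r IHr] //; elim=> [|y q IHq] //.
rewrite -[map f (x :: r)]/(f x :: map f r) in IHq *.
rewrite -[map f (y :: q)]/(f y :: map f q) !shuf_cons map_cat -!map_comp.
by rewrite IHq (IHr (y :: q)) -!map_comp.
Qed.

(** * Shuffle-invariant functions on words *)

Definition sw (i x : nat) : nat :=
  if x == i then i.+1 else if x == i.+1 then i else x.

Lemma swl i : sw i i = i.+1.
Proof. by rewrite /sw eqxx. Qed.

Lemma swr i : sw i i.+1 = i.
Proof. by rewrite /sw eqxx; case: eqP; lia. Qed.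

Lemma swo i x : x != i -> x != i.+1 -> sw i x = x.
Proof. by rewrite /sw => /negPf-> /negPf->. Qed.

Lemma swK i : involutive (sw i).
Proof. by move=> x; rewrite /sw; do !case: eqP; lia. Qed.

Lemma index_sw i x w : index x (map (sw i) w) = index (sw i x) w.
Proof. by rewrite -{1}[x](swK i) index_map //; apply: inv_inj (swK i). Qed.

Lemma perm_map_sw i w lo m : i \in w -> i.+1 \in w ->
  perm_eq w (iota lo m) -> perm_eq (map (sw i) w) (iota lo m).
Proof.
move=> iw jw wP; have wi := perm_mem wP.
apply: uniq_perm; rewrite ?iota_uniq // ?(map_inj_uniq (inv_inj (swK i))).
  by rewrite (perm_uniq wP) iota_uniq.
move=> x; rewrite -{1}[x](swK i) mem_map ?wi; last exact: inv_inj (swK i).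
move: iw jw; rewrite !wi !mem_iota /sw; do !case: eqP; lia.
Qed.

(** A missing letter has the length of the word as its index, so the strict inequalities force the
    middle letter to occur. *)
Definition between (w : seq nat) (x y z : nat) : bool :=
  (index x w < index y w < index z w) || (index z w < index y w < index x w).

(** The condition under which exchanging i and i+1 is a dual Knuth move. Writing [d.+1 = i] avoids a
    truncated predecessor at i = 0. *)
Definition wit i w :=
  [/\ i \in w, i.+1 \in w &
      exists2 d, d.+1 = i \/ d = i.+2 & between w i d i.+1].

Lemma wit_subseq i w w' : uniq w -> subseq w' w -> wit i w' -> wit i w.
Proof.
move=> wu ww' [iw' jw' [d dP bt]]; split; try exact: mem_subseq ww' _ _.
exists d => //; move: bt.
have lt x y : y \in w' -> index x w' < index y w' -> index x w < index y w.
  by move=> yw' /(subseq_index wu ww' yw').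
have dw x : x \in w' -> index d w' < index x w' -> d \in w'.
  by move=> _ /leq_trans le; rewrite -index_mem le // index_size.
case/orP => /andP[l1 l2]; apply/orP; [left|right]; apply/andP; split; auto.
  by apply: lt l1; apply: dw l2.
by apply: lt l1; apply: dw l2.
Qed.

Section ShuffleInvariant.

Context {V : zmodType}.
Implicit Types (H : seq nat -> V).

(* For a Lie element [H] the sums over proper shuffles vanish, so that only the
   case [r = [::]] says something: [H] is constant on coplactic classes. The
   point of the general form is that it is inherited by [H (c :: _)]. *)
Definition shuffle_invariant lo m H := forall i r q,
  perm_eq (r ++ q) (iota lo m) -> wit i (rev r ++ q) ->
  (\sum_(z <- shuf r q) H z =
   \sum_(z <- shuf (map (sw i) r) (map (sw i) q)) H z)%R.

Lemma shuffle_invariant_knuth lo m H i w :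
  shuffle_invariant lo m H -> perm_eq w (iota lo m) -> wit i w ->
  H (map (sw i) w) = H w.
Proof. by move=> inv wP ww; have /= := inv i [::] w wP ww; rewrite !big_seq1.
Qed.

(** Splitting the shuffles of [x :: r] and [c :: q] by their first letter gives a sum below the root
    x and one below the root c. Both belong to the same word, since [rev (x :: r) ++ c :: q] is
    [rev r ++ x :: c :: q]; so the relation travels along this word from its first letter to c. *)
Lemma shuffle_invariant_root lo m H i r c q :
  shuffle_invariant lo m H ->
  perm_eq (r ++ c :: q) (iota lo m) -> wit i (rev r ++ c :: q) ->
  (\sum_(z <- shuf r q) H (c :: z) =
   \sum_(z <- shuf (map (sw i) r) (map (sw i) q)) H (sw i c :: z))%R.
Proof.
move=> inv; elim: r c q => [|x r IHr] c q pe wi.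
  by have /= := inv i [::] (c :: q) pe wi; rewrite !big_seq1.
have := inv i (x :: r) (c :: q) pe wi.
rewrite /= -/(shuf (x :: r) (c :: q)).
rewrite -/(shuf (sw i x :: map (sw i) r) (sw i c :: map (sw i) q)).
rewrite !big_shuf_cons.
have -> := IHr x (c :: q); first by move/addrI.
  by rewrite (perm_catCA r [:: x] (c :: q)).
by rewrite -cat_rcons -rev_cons.
Qed.

(** The remaining letters form an interval, so c is extreme and fixed by the exchange; inserting it
    as a root between [rev r] and [q] does not destroy a witness. *)
Lemma shuffle_invariant_cons lo m lo' m' c H :
  perm_eq (c :: iota lo' m') (iota lo m) ->
  shuffle_invariant lo m H -> shuffle_invariant lo' m' (fun z => H (c :: z)).
Proof.
move=> cP inv i r q pe wi.
have pe' : perm_eq (r ++ c :: q) (iota lo m).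
  by rewrite -(permPr cP) (perm_catCA r [:: c] q) perm_cons.
have cn : c \notin r ++ q.
  have: uniq (c :: r ++ q) by rewrite -(perm_uniq (permEl (perm_catCA r [:: c]
    q))) (perm_uniq pe') iota_uniq.
  by case/andP.
have wi' : wit i (rev r ++ c :: q).
  apply: wit_subseq wi; last by apply: cat_subseq => //; apply: subseq_cons.
  have -> : uniq (rev r ++ c :: q) = uniq (r ++ c :: q).
    by apply: perm_uniq; rewrite perm_cat2r perm_rev.
  by rewrite (perm_uniq pe') iota_uniq.
rewrite (shuffle_invariant_root inv pe' wi') swo //; case: wi => iw jw _.
  by apply: contraNneq cn => ->; move: iw; rewrite !mem_cat mem_rev.
by apply: contraNneq cn => ->; move: jw; rewrite !mem_cat mem_rev.
Qed.

End ShuffleInvariant.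

(** * Descents *)

Definition des (w : seq nat) : seq bool :=
  if w is x :: t then pairmap (fun a b => b < a) x t else [::].

Definition apart i : seq nat -> bool :=
  sorted (fun a b =>
    ~~ ((a == i) && (b == i.+1) || (a == i.+1) && (b == i))).

Lemma des_sw i w : apart i w -> des (map (sw i) w) = des w.
Proof.
case: w => //= x w; elim: w x => //= y w IHw x /andP[xy /IHw->].
by congr cons; move: xy; rewrite /sw; do !case: eqP; lia.
Qed.

Lemma apartP i w : uniq w ->
  (i \in w -> i.+1 \in w -> (index i w).+1 != index i.+1 w) ->
  (i \in w -> i.+1 \in w -> (index i.+1 w).+1 != index i w) -> apart i w.
Proof.
move=> uw n1 n2; apply/(sortedP 0) => j lj.
have lj' := ltnW lj.
have E1 := index_uniq 0 lj' uw; have E2 := index_uniq 0 lj uw.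
apply/negP => /orP[] /andP[/eqP e1 /eqP e2]; rewrite e1 in E1; rewrite e2 in E2.
  have iw : i \in w by rewrite -e1 mem_nth.
  have jw : i.+1 \in w by rewrite -e2 mem_nth.
  by have /eqP[] := n1 iw jw; rewrite E1 E2.
have jw : i.+1 \in w by rewrite -e1 mem_nth.
have iw : i \in w by rewrite -e2 mem_nth.
by have /eqP[] := n2 iw jw; rewrite E1 E2.
Qed.

Lemma wit_apart i w : uniq w -> wit i w -> apart i w.
Proof.
move=> uw [_ _ [d _ bt]]; apply: apartP => // _ _; apply/eqP => e;
move: bt; rewrite /between; lia.
Qed.


Lemma catr_uniq (T : eqType) (p q : seq T) : uniq (p ++ q) -> uniq q.
Proof. by rewrite cat_uniq => /and3P[]. Qed.

Lemma big_shufC (T : eqType) (V : nmodType) (F : seq T -> V) r q :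
  (\sum_(z <- shuf r q) F z = \sum_(z <- shuf q r) F z)%R.
Proof.
elim: r q F => [|x r IHr] q F; first by rewrite shufr0.
elim: q F => [|y q IHq] F //.
by rewrite !big_shuf_cons IHq IHr addrC.
Qed.

(** * Sums of functions of the descents over shuffles *)

Section DescentFunctions.

Context {V : zmodType} (k : seq bool -> V) (i : nat).
Implicit Types (p r q z : seq nat).

(** The defect of invariance. It is zero unless i and i+1 are adjacent, since only then does the
    exchange alter a comparison of neighbours. *)
Let D w : V := (k (des w) - k (des (map (sw i) w)))%R.

Let swapped a b := (a == i) && (b == i.+1) || (a == i.+1) && (b == i).

Let D_apart p a b z : swapped a b -> b \notin p -> uniq (p ++ a :: z) ->
  head a z != b -> D (p ++ a :: z) = 0%R.
Proof.
move=> ab bp u hz; rewrite /D des_sw ?subrr //.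
have key : b \in p ++ a :: z -> index a (p ++ a :: z) = size p /\
    (size p).+1 < index b (p ++ a :: z).
  have ba : (b == a) = false by move: ab; rewrite /swapped; lia.
  rewrite mem_cat (negPf bp) /= inE ba /=.
  move: u; rewrite cat_uniq /= negb_or => /and3P[_ /andP[ap _] _] bz.
  rewrite !index_cat (negPf ap) (negPf bp) /= eqxx [a == b]eq_sym ba addn0.
  split=> //; case: z hz bz => //= c z hz _; rewrite (negPf hz); lia.
case/orP: ab => /andP[/eqP ea /eqP eb]; rewrite ea eb in u key *;
apply: apartP => // iw jw; apply/eqP.
- by case: (key jw) => ->; lia.
- by case: (key jw) => ->; lia.
- by case: (key iw) => ->; lia.
- by case: (key iw) => ->; lia.
Qed.

(** The exchange turns the two words into each other, and D is antisymmetric. *)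
Let D_pair p a b z : swapped a b -> uniq (p ++ a :: b :: z) ->
  (D (p ++ a :: b :: z) + D (p ++ b :: a :: z) = 0)%R.
Proof.
move=> ab; rewrite cat_uniq /= !inE !negb_or.
case/and3P=> _ /and3P[ap bp _] /and3P[/andP[_ az] bz _].
have fix_ s : a \notin s -> b \notin s -> map (sw i) s = s.
  move=> an bn; rewrite -[RHS]map_id; apply/eq_in_map => x xs.
  have xa : x != a by apply: contraNneq an => <-.
  have xb : x != b by apply: contraNneq bn => <-.
  by case/orP: ab => /andP[/eqP ea /eqP eb]; rewrite ea eb in xa xb; apply: swo.
rewrite /D !map_cat /= !fix_ //.
have [-> ->] : sw i a = b /\ sw i b = a.
  by case/orP: ab => /andP[/eqP-> /eqP->]; rewrite swl swr.
by rewrite addrC subrKA subrr.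
Qed.

(** If b heads neither remaining word, it cannot follow a. The default of [head] is a, so that an
    empty word satisfies the condition. *)
Let sum_apart p a b r q : swapped a b -> uniq (p ++ a :: r ++ q) ->
  b \in r ++ q -> head a r != b -> head a q != b ->
  (\sum_(z <- shuf r q) D (p ++ a :: z) = 0)%R.
Proof.
move=> ab u brq hr hq; rewrite big_seq big1 // => z zP.
have pe : perm_eq (p ++ a :: z) (p ++ a :: r ++ q).
  by rewrite perm_cat2l perm_cons shuf_perm.
apply: (@D_apart _ _ b) => //.
- move: u; rewrite cat_uniq => /and3P[_ /hasPn/(_ b) h _]; apply: h.
  by rewrite inE brq orbT.
- by rewrite (perm_uniq pe).
- case: r q hr hq zP {u brq pe} => [|x r] [|y q] hr hq;
    rewrite ?shufr0 ?inE; try by move/eqP->.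
  by rewrite shuf_cons mem_cat => /orP[] /mapP[z' _ ->].
Qed.

(** Only the shuffles that read b right after a contribute. *)
Let sum_next p a b r q : swapped a b -> uniq (p ++ a :: r ++ b :: q) ->
  (\sum_(z <- shuf r (b :: q)) D (p ++ a :: z) =
   \sum_(z <- shuf r q) D (p ++ a :: b :: z))%R.
Proof.
move=> ab u; case: r u => [|x r] u; first by rewrite !big_seq1.
have xb : x != b.
  move: u; rewrite -cat_rcons => /catr_uniq; rewrite cat_cons /=.
  by rewrite mem_cat inE !negb_or => /andP[/and3P[_]].
rewrite big_shuf_cons;
  under eq_bigr do rewrite -[a :: x :: _]/([:: a] ++ x :: _).
have -> : (\sum_(z <- shuf r (b :: q)) D (p ++ [:: a] ++ x :: z) = 0)%R.
  rewrite big_seq big1 // => z zP.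
  apply: (@D_apart _ _ b) => //.
  - move: u; rewrite cat_uniq => /and3P[_ /hasPn/(_ b) h _]; apply: h.
    by rewrite inE mem_cat !inE eqxx !orbT.
  - have pe : perm_eq (p ++ a :: x :: z) (p ++ a :: (x :: r) ++ b :: q).
      by rewrite perm_cat2l /= !perm_cons shuf_perm.
    by rewrite (perm_uniq pe).
by rewrite add0r.
Qed.

Let head_neq a b r : a != b -> b \notin r -> head a r != b.
Proof. by case: r => //= c r _; rewrite inE negb_or eq_sym => /andP[]. Qed.

(** As i and i+1 come from different words, the shuffles in which they are adjacent occur in pairs
    with cancelling defects. The induction reads the shuffle letter by letter; p is the prefix
    already read. *)
Lemma big_shuf_des r q : uniq (r ++ q) -> i \in r -> i.+1 \in q ->
  (\sum_(z <- shuf r q) k (des z) =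
   \sum_(z <- shuf (map (sw i) r) (map (sw i) q)) k (des z))%R.
Proof.
move=> u ir jq; rewrite shuf_map big_map; apply/eqP.
rewrite -subr_eq0 -sumrB -/(D _); apply/eqP.
have {u} : uniq ([::] ++ r ++ q) by [].
rewrite -[LHS]/(\sum_(z <- shuf r q) D ([::] ++ z))%R.
move: [::] => p; move: {2}(size r + size q) (leqnn (size r + size q)) => n.
elim: n r q p ir jq => [|n IHn] [|x r] // [|y q] // p ir jq le u.
rewrite big_shuf_cons.
have ux : uniq (rcons p x ++ r ++ y :: q) by rewrite cat_rcons.
have uy : uniq (rcons p y ++ (x :: r) ++ q).
  have pe : perm_eq (rcons p y ++ (x :: r) ++ q) (p ++ (x :: r) ++ y :: q).
    by rewrite cat_rcons perm_cat2l -cat1s perm_catCA.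
  by rewrite (perm_uniq pe).
under eq_bigr do rewrite -cat_rcons.
under [X in (_ + X)%R]eq_bigr do rewrite -cat_rcons.
have [ex|nx] := eqVneq x i; have [ey|ny] := eqVneq y i.+1.
(* Both letters are in front: reading them in either order leaves the same shuffles of r and q, and
   the terms cancel one by one. *)
- subst x y; under eq_bigr do rewrite cat_rcons.
  under [X in (_ + X)%R]eq_bigr do rewrite cat_rcons.
  rewrite [X in (_ + X)%R]big_shufC.
  have sij : swapped i i.+1 by rewrite /swapped !eqxx.
  have sji : swapped i.+1 i by rewrite /swapped !eqxx orbT.
  rewrite (sum_next sij) // (sum_next sji); last first.
    have pe : perm_eq (p ++ i.+1 :: q ++ i :: r) (rcons p i.+1 ++ (i :: r) ++
      q).
      by rewrite cat_rcons perm_cat2l perm_cons perm_catC.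
    by rewrite (perm_uniq pe).
  rewrite [X in (_ + X)%R]big_shufC -big_split big_seq big1 //= => z zP.
  apply: D_pair => //.
  have pe : perm_eq (p ++ [:: i, i.+1 & z]) (p ++ (i :: r) ++ i.+1 :: q).
    rewrite perm_cat2l /= perm_cons perm_sym (perm_catCA r [:: i.+1] q)
      perm_cons.
    by rewrite perm_sym shuf_perm.
  by rewrite (perm_uniq pe).
- subst x; rewrite inE eq_sym (negPf ny) /= in jq.
  under eq_bigr do rewrite cat_rcons.
  have sij : swapped i i.+1 by rewrite /swapped !eqxx.
  have jr : i.+1 \notin i :: r.
    move: u => /catr_uniq; rewrite cat_uniq => /and3P[_ /hasPn h _].
    by apply: h; rewrite inE jq orbT.
  rewrite (sum_apart sij) //; last 2 first.
  + by rewrite mem_cat inE jq !orbT.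
  + by apply: head_neq; [rewrite ltn_eqF | case/norP: jr].
  rewrite add0r; apply: IHn => //.
  by move: le => /=; lia.
- subst y; rewrite inE eq_sym (negPf nx) /= in ir.
  under [X in (_ + X)%R]eq_bigr do rewrite cat_rcons.
  have sji : swapped i.+1 i by rewrite /swapped !eqxx orbT.
  have iq : i \notin i.+1 :: q.
    move: u => /catr_uniq; rewrite uniq_catC cat_uniq => /and3P[_ /hasPn h _].
    by apply: h; rewrite inE ir orbT.
  rewrite [X in (_ + X)%R](sum_apart sji) //; last 3 first.
  + by move: uy; rewrite cat_rcons.
  + by rewrite mem_cat inE ir !orbT.
  + by apply: head_neq; [rewrite gtn_eqF | case/norP: iq].
  rewrite addr0; apply: IHn => //.
- rewrite inE eq_sym (negPf nx) /= in ir;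
    rewrite inE eq_sym (negPf ny) /= in jq.
  rewrite !IHn ?addr0 ?inE ?ir ?jq ?orbT //.
  by move: le => /=; rewrite addnS.
Qed.

End DescentFunctions.

(** * Words beginning with an ascent *)

Lemma shufC_mem (T : eqType) (r q z : seq T) :
  z \in shuf r q -> z \in shuf q r.
Proof.
move: r q z; apply: shuf_ind => [q|r|x r y q z _ zP|x r y q z _ zP].
- by rewrite shufr0 inE.
- by rewrite inE.
- by rewrite shuf_cons mem_cat map_f ?orbT.
- by rewrite shuf_cons mem_cat map_f.
Qed.

Lemma index_neq (T : eqType) (w : seq T) x y :
  x \in w -> x != y -> index x w != index y w.
Proof.
move=> xw; apply: contraNneq => e; rewrite -(nth_index x xw) e nth_index //.
by rewrite -index_mem -e index_mem.
Qed.

Lemma sw_l i x : x = i -> sw i x = i.+1.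
Proof. by move->; apply: swl. Qed.

Lemma sw_r i x : x = i.+1 -> sw i x = i.
Proof. by move->; apply: swr. Qed.

Ltac sw_simp := rewrite ?index_sw; repeat match goal with
  |- context [sw ?i ?x] => lazymatch x with context [sw _ _] => fail | _ =>
    first [rewrite (@sw_l i x); [|lia] | rewrite (@sw_r i x); [|lia]
          |rewrite (@swo i x); [|lia|lia]] end end.

Lemma sw_lt i x y : x < y -> ~~ ((x == i) && (y == i.+1)) -> sw i x < sw i y.
Proof. by rewrite /sw; do !case: eqP; lia. Qed.

Lemma subseq_order (T : eqType) (w q : seq T) x y :
  uniq w -> subseq q w -> x \in q -> y \in q ->
  (index x q < index y q) = (index x w < index y w).
Proof.
move=> uw qw xq yq; apply/idP/idP; first exact: subseq_index.
move=> lt; rewrite ltnNge leq_eqVlt; apply/negP => /orP[/eqP e|gt].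
  by move: lt; rewrite -(nth_index x xq) -e nth_index // ltnn.
by have := subseq_index uw qw xq gt; rewrite ltnNge ltnW.
Qed.

Lemma mem_before (T : eqType) (p q : seq T) x y :
  index x (p ++ y :: q) < index y (p ++ y :: q) -> x \in p.
Proof.
rewrite !index_cat; case: ifP => // _; case: ifP => [yp|_].
  by have := yp; rewrite -index_mem; lia.
by rewrite /= eqxx; lia.
Qed.

Lemma mem_after (T : eqType) (p q : seq T) x y : x \in p ++ y :: q ->
  y \notin p -> index y (p ++ y :: q) <= index x (p ++ y :: q) -> x \in y :: q.
Proof.
rewrite mem_cat => /orP[xp|//] yp; rewrite !index_cat xp (negPf yp) /= eqxx.
by move: xp; rewrite -index_mem; lia.
Qed.

Lemma index_pivot (T : eqType) (p q : seq T) y :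
  y \notin p -> index y (p ++ y :: q) = size p.
Proof. by move=> yp; rewrite index_cat (negPf yp) /= eqxx addn0. Qed.

Lemma shuf_nth0 (r q z : seq nat) c : 0 < size r -> 0 < size q ->
  c < nth 0 r 0 -> c < nth 0 q 0 -> z \in shuf r q -> c < nth 0 z 0.
Proof.
case: r q => [|x r] [|y q] // _ _ cx cy; rewrite shuf_cons mem_cat.
by case/orP=> /mapP[z' _ ->].
Qed.

Section Core.

Context {V : zmodType} (lo m : nat) (G : seq nat -> V).
Hypothesis G_sw : forall i (w : seq nat),
  perm_eq w (iota lo m) -> wit i w -> G (map (sw i) w) = G w.
Hypothesis G_root : forall (i c : nat) (r q : seq nat),
  perm_eq (c :: r ++ q) (iota lo m) -> i \in r -> i.+1 \in q ->
  wit i (rev r ++ c :: q) ->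
  (\sum_(z <- shuf r q) G (c :: z) =
   \sum_(z <- shuf (map (sw i) r) (map (sw i) q)) G (c :: z))%R.
Hypothesis G_lo : forall y, perm_eq (lo :: y) (iota lo m) -> G (lo :: y) = 0%R.

(** The default 0 of [nth] makes the last inequality fail unless there is a second letter. *)
Definition starts (t : nat) (w : seq nat) :=
  [/\ perm_eq w (iota lo m), nth 0 w 0 = t & t < nth 0 w 1].

Section Starts.

Variables (t : nat) (w : seq nat).
Hypothesis tw : starts t w.

Lemma starts_mem x : (x \in w) = (lo <= x < lo + m).
Proof. by case: tw => wP _ _; rewrite (perm_mem wP) mem_iota. Qed.

Lemma starts_uniq : uniq w.
Proof. by case: tw => wP _ _; rewrite (perm_uniq wP) iota_uniq. Qed.

Lemma starts_size : 1 < size w.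
Proof.
case: tw => _ _ lt; rewrite ltnNge; apply/negP => le; move: lt.
by rewrite (nth_default _ le).
Qed.

Lemma starts_cons : exists l y, w = [:: t, l & y] /\ t < l.
Proof.
case: tw => _; have := starts_size; case: w => [|x [|l y]] //= _ <-.
by exists l, y.
Qed.

Lemma starts_index : index t w = 0.
Proof. by have [l [y [-> _]]] := starts_cons; rewrite /= eqxx. Qed.

Lemma starts_in : lo <= t < lo + m.
Proof. by rewrite -starts_mem -index_mem starts_index ltnW // starts_size. Qed.

Lemma starts_index_lt x y : index x w < index y w -> lo <= x < lo + m.
Proof.
move=> lt; rewrite -starts_mem -index_mem; apply: leq_trans lt _.
exact: index_size.
Qed.

Lemma starts_index_neq x y : lo <= x < lo + m -> x <> y ->
  index x w <> index y w.
Proof.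
by rewrite -starts_mem => xw /eqP xy; apply/eqP; apply: index_neq.
Qed.

Lemma starts_wit i d : d.+1 = i \/ d = i.+2 ->
  lo <= i -> i.+1 < lo + m -> between w i d i.+1 -> wit i w.
Proof. by move=> di l1 l2 bt; split; [rewrite starts_mem; lia..|exists d]. Qed.

(** The witness separates i from i+1, so they are not the first two letters and the initial ascent
    survives. *)
Lemma starts_sw i : wit i w -> starts (sw i t) (map (sw i) w).
Proof.
move=> wi; case: (tw) => wP e0 lt; case: (wi) => iw jw [d di bt]; split.
- exact: perm_map_sw.
- by rewrite (nth_map 0) ?e0 // ltnW // starts_size.
- rewrite (nth_map 0) ?starts_size //; apply: sw_lt => //.
  apply/negP => /andP[/eqP ti /eqP li]; move: bt; rewrite /between.
  have [l [y [ew _]]] := starts_cons.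
  by move: li; rewrite ew -ti /= => ->; rewrite !eqxx; do !case: eqP; lia.
Qed.

Lemma starts_G_sw i : wit i w -> G (map (sw i) w) = 0%R -> G w = 0%R.
Proof. by case: tw => wP _ _ wi <-; rewrite G_sw. Qed.

End Starts.

(** In the relation of [G_root] every term but one vanishes. The letter i-1 is b or c, which are
    adjacent in the middle of [rev r ++ b :: c :: q], with i on their left (b itself if c is i-1 and
    b is i) and i+1 on their right; this is the witness. *)
Lemma root_isolate (i c b : nat) (r q z0 : seq nat) :
  perm_eq (c :: (b :: r) ++ q) (iota lo m) ->
  i \in b :: r -> i.+1 \in q -> b.+1 = i \/ c.+1 = i ->
  z0 \in shuf (b :: r) q ->
  (forall z, z \in shuf (b :: r) q -> z != z0 -> G (c :: z) = 0%R) ->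
  (forall z, z \in shuf (map (sw i) (b :: r)) (map (sw i) q) ->
     G (c :: z) = 0%R) ->
  G (c :: z0) = 0%R.
Proof.
move=> pe ir jq bc z0P zl zr.
have u : uniq (c :: (b :: r) ++ q) by rewrite (perm_uniq pe) iota_uniq.
have wi : wit i (rev (b :: r) ++ c :: q).
  have := u; rewrite cons_uniq mem_cat negb_or cat_uniq.
  case/andP=> /andP[cr cq] /and3P[ubr /hasPn rq _].
  have iq : i \notin q by apply/negP => /rq/negP.
  have jr : i.+1 \notin b :: r by apply: rq.
  have ci : c <> i by move=> e; move: cr; rewrite e ir.
  have cj : c <> i.+1.
    by move=> e; move: cq; rewrite e jq.
  split; rewrite ?mem_cat ?mem_rev ?ir ?inE ?jq ?orbT //.
  have Ij : (size r).+1 < index i.+1 (rev (b :: r) ++ c :: q).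
    rewrite index_cat mem_rev (negPf jr) size_rev /=.
    by rewrite (introF eqP cj) addnS ltnS leq_addr.
  case: bc => [bi|ci'].
    exists b; first by left.
    have nib : i != b by rewrite -bi gtn_eqF.
    have ir' : i \in r by move: ir; rewrite inE (negPf nib).
    have br : b \notin r by case/andP: ubr.
    have er : rev (b :: r) ++ c :: q = rev r ++ b :: c :: q by rewrite rev_cons
      cat_rcons.
    rewrite er in Ij *; rewrite /between; apply/orP; left; apply/andP; split.
      rewrite !index_cat !mem_rev ir' (negPf br) /= eqxx.
      by rewrite addn0 size_rev -(size_rev r) index_mem mem_rev.
    rewrite [X in X < _]index_cat mem_rev (negPf br) /= eqxx.
    by rewrite addn0 size_rev; apply: ltnW.
  exists c; first by left.
  rewrite /between; apply/orP; left; apply/andP; split.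
    rewrite !index_cat !mem_rev ir (negPf cr) /= eqxx addn0.
    by rewrite index_mem mem_rev.
  by rewrite [X in X < _]index_cat mem_rev (negPf cr) /= eqxx addn0 size_rev.
have := G_root pe ir jq wi; rewrite [RHS]big_seq [RHS]big1 => [|z zP];
  last first.
  exact: zr.
have us : uniq (shuf (b :: r) q) by apply: shuf_uniq; case/andP: u.
rewrite (bigD1_seq z0 z0P us) {us}.
rewrite big_seq_cond big1 => [|z /andP[]]; last exact: zl.
by rewrite /= addr0.
Qed.

(** * The other shuffles below the root *)

Section Root.

Variables (c b : nat) (r q z0 : seq nat).
Hypotheses (cz0 : starts c (c :: z0)) (z0P : z0 \in shuf (b :: r) q).
Hypotheses (cb : c < b) (cq : c < nth 0 q 0).

Let q_gt0 : 0 < size q. Proof. by case: q cq. Qed.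

Lemma root_perm : perm_eq (c :: (b :: r) ++ q) (iota lo m).
Proof.
case: cz0 => pe _ _; apply: perm_trans pe.
by rewrite perm_cons perm_sym shuf_perm.
Qed.

Lemma root_starts z : z \in shuf (b :: r) q -> starts c (c :: z).
Proof.
move=> zP; split=> //=; last exact: shuf_nth0 zP.
by apply: perm_trans root_perm; rewrite perm_cons; apply: shuf_perm.
Qed.

(** All these words contain [c :: q] as a subword, so the order of its letters can be read off in
    z0. *)
Lemma root_order z x y : z \in shuf (b :: r) q ->
  x \in c :: q -> y \in c :: q ->
  (index x (c :: z) < index y (c :: z)) =
  (index x (c :: z0) < index y (c :: z0)).
Proof.
move=> zP xq yq; have sub z' : z' \in shuf (b :: r) q ->
  uniq (c :: z') && subseq (c :: q) (c :: z').
  move=> zP'; rewrite (starts_uniq (root_starts zP')) /= eqxx.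
  exact: shuf_subseqr zP'.
case/andP: (sub z zP) => u1 s1; case/andP: (sub z0 z0P) => u2 s2.
by rewrite -(subseq_order u1 s1) // -(subseq_order u2 s2).
Qed.

Variable i : nat.
Hypotheses (ci : c < i) (ir : i \in b :: r) (jq : i.+1 \in q).

Let gt_sw y : c < y -> c < sw i y.
Proof. by rewrite /sw; do !case: eqP; lia. Qed.

Lemma root_starts_sw z :
  z \in shuf (map (sw i) (b :: r)) (map (sw i) q) -> starts c (c :: z).
Proof.
move=> zP; split=> //=; last first.
  by apply: shuf_nth0 zP; rewrite ?size_map ?(nth_map 0) //; apply: gt_sw.
have ec : sw i c = c by rewrite swo // ?ltn_eqF // ltnW.
have iw : i \in c :: (b :: r) ++ q by rewrite inE mem_cat ir orbT.
have jw : i.+1 \in c :: (b :: r) ++ q by rewrite inE mem_cat jq !orbT.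
apply: perm_trans (perm_map_sw iw jw root_perm).
by rewrite map_cons ec perm_cons map_cat shuf_perm.
Qed.

Lemma root_order_sw z x y :
  z \in shuf (map (sw i) (b :: r)) (map (sw i) q) ->
  sw i x \in c :: q -> sw i y \in c :: q ->
  (index x (c :: z) < index y (c :: z)) =
  (index (sw i x) (c :: z0) < index (sw i y) (c :: z0)).
Proof.
move=> zP xq yq; have ec : sw i c = c by rewrite swo // ?ltn_eqF // ltnW.
have s : subseq (map (sw i) (c :: q)) (c :: z).
  by rewrite map_cons ec /= eqxx (shuf_subseqr zP).
have mem t : sw i t \in c :: q -> t \in map (sw i) (c :: q).
  by move=> tq; rewrite -[t](swK i) map_f.
rewrite -(subseq_order (starts_uniq (root_starts_sw zP)) s) ?mem // !index_sw.
have s0 : subseq (c :: q) (c :: z0) by rewrite /= eqxx (shuf_subseqr z0P).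
by rewrite (subseq_order (starts_uniq cz0) s0).
Qed.

End Root.

(** * From head letter a to head letter a+1 *)

Section Step.

Variables (a : nat).
Hypothesis loa : lo <= a.
Hypothesis G_a : forall w, starts a w -> G w = 0%R.

Definition decreasing_upto (t : nat) (w : seq nat) := forall x y : nat,
  a <= x -> x < y -> y <= t -> index y w < index x w.

(* The exchanges t+1 <-> t, t <-> t-1, .. lower the head letter to a. *)
Lemma G_low t (w : seq nat) : a <= t -> starts t.+1 w -> decreasing_upto t w ->
  index t.+2 w < index t w -> G w = 0%R.
Proof.
elim/ltn_ind: t w => t IHt w at_ tw dec lt.
have wi : wit t w.
  have ti := starts_in tw; apply: (starts_wit tw (d := t.+2)); auto; try lia.
  have := starts_index_neq tw ti (y := t.+2).
  by rewrite /between (starts_index tw); lia.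
apply: (starts_G_sw tw wi); have := starts_sw tw wi; rewrite swr => tw'.
case: (eqVneq a t) => [ea|na]; first by apply: G_a; rewrite ea.
case: t => [|t] in IHt at_ tw dec lt wi tw' na *; first by lia.
have {}at_ : a <= t by lia.
apply: (IHt t _ _ _ tw') => // [x y ax xy yt|]; rewrite !index_sw.
  by rewrite !swo; [apply: dec|..]; lia.
by rewrite swr swo; [apply: dec|..]; lia.
Qed.


(** Four exchanges lower the head letter. In offsets from t, the order 2 4 1 0 3 becomes 3 4 1 0 2,
    then 3 4 2 0 1, 2 4 3 0 1 and 1 4 3 0 2; the witnesses are 1, 0, 4 and 3. *)
Lemma G_star_descend t (w : seq nat) : a <= t -> starts t.+2 w ->
  decreasing_upto t.+1 w ->
  index t.+4 w < index t.+1 w -> index t w < index t.+3 w ->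
  (forall w', starts t.+1 w' -> decreasing_upto t w' ->
     index t.+3 w' < index t w' -> G w' = 0%R) -> G w = 0%R.
Proof.
move=> at_ tw dec lt lt' Gt.
have p1 : 0 < index t.+4 w.
  have := starts_index_neq tw (starts_in tw) (y := t.+4).
  by rewrite (starts_index tw); lia.
have p2 : index t.+1 w < index t w by apply: dec; lia.
have p0 := starts_index tw.
have i4 : t.+4 < lo + m by have := starts_index_lt tw lt; lia.
have w1 : wit t.+2 w.
  by apply: (starts_wit tw (d := t.+1)); rewrite /between; auto; lia.
apply: (starts_G_sw tw w1); have := starts_sw tw w1; rewrite swl => {}tw.
have w2 : wit t.+1 (map (sw t.+2) w).
  apply: (starts_wit tw (d := t)); auto; try lia.
  by rewrite /between; sw_simp; lia.
apply: (starts_G_sw tw w2); have := starts_sw tw w2; rewrite swo; try lia.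
move=> {}tw; set w' := map (sw t.+1) (map (sw t.+2) w).
have w3 : wit t.+2 w'.
  apply: (starts_wit tw (d := t.+4)); auto; try lia.
  by rewrite /between; sw_simp; lia.
apply: (starts_G_sw tw w3); have := starts_sw tw w3; rewrite swr => {}tw.
have w4 : wit t.+1 (map (sw t.+2) w').
  apply: (starts_wit tw (d := t.+3)); auto; try lia.
  by rewrite /between; sw_simp; lia.
apply: (starts_G_sw tw w4); have := starts_sw tw w4; rewrite swr => {}tw.
apply: Gt => // [x y ax xy yt|]; sw_simp; last by lia.
by apply: dec; lia.
Qed.

(* [root_isolate] applied to the block that starts at t+2 (and ends before t-1):
   the other shuffles are covered by [G_low] and [G_star_descend], or have t+2
   further to the left, or else t-1. *)
Lemma G_star t (w : seq nat) : a <= t -> starts t.+1 w -> decreasing_upto t w ->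
  index t.+3 w < index t w -> G w = 0%R.
Proof.
elim/ltn_ind: t w => t IHt w at_.
have desc (w' : seq nat) : starts t.+1 w' -> decreasing_upto t w' ->
    index t.+3 w' < index t w' -> a < t -> index t.-1 w' < index t.+2 w' ->
    G w' = 0%R.
  case: t IHt {at_} => // t IHt tw dec lt at_ lt2.
  by apply: (G_star_descend (t := t)) => // w2; apply: IHt.
have [n le] := ubnP (index t.+2 w); elim: n w le => // n IHn w le.
have [n' le'] := ubnP (index t.-1 w); elim: n' w le le' => // n' IHn' w le le'.
move=> tw dec lt; have tin := starts_in tw; have p0 := starts_index tw.
case: (ltnP (index t.+2 w) (index t w)) => [lt1|ge1].
  exact: G_low lt1.
have ne1 : index t w <> index t.+2 w by apply: (starts_index_neq tw); lia.
have {ne1}lt1 : index t w < index t.+2 w by lia.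
have i3 : t.+3 < lo + m by have := starts_index_lt tw lt; lia.
case: (boolP ((a < t) && (index t.-1 w < index t.+2 w))) => [/andP[]|nlt2].
  exact: desc.
have [w0 [ew tl]] : exists w0, w = t.+1 :: w0 /\ t.+1 < nth 0 w0 0.
  by have [l [y [-> tl]]] := starts_cons tw; exists (l :: y).
have t2w : t.+2 \in w0.
  by have : t.+2 \in w; [rewrite (starts_mem tw); lia|rewrite ew inE gtn_eqF].
have uw := starts_uniq tw.
move: ew tl; case/splitPr: {w0} t2w => qa rest ew tl.
have bef (x : nat) : index x w < index t.+2 w -> x \in t.+1 :: qa.
  by rewrite ew -cat_cons => /mem_before.
have tqa : t \in qa by have := bef _ lt1; rewrite inE ltn_eqF.
have t3qa : t.+3 \in qa.
  by have := bef _ (ltn_trans lt lt1); rewrite inE gtn_eqF.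
have {}tl X : t.+1 < nth 0 (qa ++ X) 0 by case: qa tqa tl {ew bef t3qa}.
(* Cutting the block off before t-1 leaves all letters of [a, t] in [qa ++ X], where shuffling
   cannot disturb their order. For t = a the block reaches the end of the word. *)
have [Q1 [X [er XP]]] : exists Q1 X : seq nat, rest = Q1 ++ X /\
    ((t = a /\ X = [::]) \/ (a < t /\ exists Q2, X = t.-1 :: Q2)).
  case: (eqVneq t a) => [|na]; first by exists rest, [::]; rewrite cats0; auto.
  have tr : t.-1 \in t.+2 :: rest.
    apply: (@mem_after _ (t.+1 :: qa)); rewrite ?cat_cons -?ew.
    + by rewrite (starts_mem tw); lia.
    + by move: uw; rewrite ew -cat_cons cat_uniq => /and3P[_ /norP[]].
    + by move: nlt2; lia.
  have {}tr : t.-1 \in rest by move: tr; rewrite inE ltn_eqF //; lia.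
  case/splitPr: tr => Q1 Q2; exists Q1, (t.-1 :: Q2); split=> //.
  by right; split; [lia|exists Q2].
rewrite {rest}er in ew.
have inq x : a <= x <= t -> x \in t.+1 :: qa ++ X.
  case: (eqVneq x t) => [->|xt axt]; first by rewrite inE mem_cat tqa !orbT.
  case: XP => [[]|[at' [Q2 eX]]]; first by lia.
  suff : x \in X by rewrite inE mem_cat => ->; rewrite !orbT.
  have ew' : w = (t.+1 :: qa ++ t.+2 :: Q1) ++ t.-1 :: Q2.
    by rewrite ew eX /= -catA.
  rewrite eX; apply: (@mem_after _ (t.+1 :: qa ++ t.+2 :: Q1)); rewrite -?ew'.
  + by rewrite (starts_mem tw); lia.
  + by move: uw; rewrite ew' cat_uniq => /and3P[_ /norP[]].
  + have [->//|nx] := eqVneq x t.-1.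
    by apply: ltnW; apply: dec; lia.
have t3q : t.+3 \in qa ++ X by rewrite mem_cat t3qa.
set z0 := qa ++ t.+2 :: Q1 ++ X in ew.
have z0P : z0 \in shuf (t.+2 :: Q1) (qa ++ X).
  exact: mem_shuf_cat (mem_shuf0 _ _).
rewrite ew in tw dec lt le le' uw lt1 *.
have t23 : t.+1 < t.+2 by [].
have ir : t.+2 \in t.+2 :: Q1 by rewrite inE eqxx.
apply: (root_isolate (root_perm tw z0P) ir t3q) => [|//|z zP nz|z zP].
- by auto.
- have tz := root_starts tw z0P t23 (tl X) zP.
  have ord := root_order tw z0P t23 (tl X) zP.
  have decz : decreasing_upto t (t.+1 :: z).
    move=> x y ax xy yt; have [] : a <= x <= t /\ a <= y <= t.
      by move: ax xy yt; clear; lia.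
    by move=> /inq xq /inq yq; rewrite ord //; apply: dec.
  case: (ltnP (index t.+2 (t.+1 :: z)) (index t (t.+1 :: z))) => [|le1].
    exact: G_low tz decz.
  have ltz : index t.+3 (t.+1 :: z) < index t (t.+1 :: z).
    by rewrite ord //; [rewrite inE t3q orbT|apply: inq; rewrite at_ leqnn].
  have [q1 [q2 [z' [eq ez z'P]]]] := shuf_split zP.
  have uz : uniq ((t.+1 :: q1) ++ t.+2 :: z').
    by have := starts_uniq tz; rewrite ez.
  have i2z : index t.+2 (t.+1 :: z) = (size q1).+1.
    rewrite ez -cat_cons index_pivot //.
    by move: uz; rewrite cat_uniq => /and3P[_ /norP[]].
  have i2w : index t.+2 (t.+1 :: z0) = (size qa).+1.
    rewrite -cat_cons index_pivot //.
    by move: uw; rewrite -cat_cons cat_uniq => /and3P[_ /norP[]].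
  case: (ltngtP (size q1) (size qa)) => [lts|gts|es].
  + apply: (IHn _ _ tz decz ltz); rewrite i2z; rewrite i2w in le.
    by move: lts le; clear; lia.
  + case: XP => [[_ eX]|[at' [Q2 eX]]].
      by move: (congr1 (@size nat) eq) gts; rewrite eX !size_cat /=; clear; lia.
    apply: (desc _ tz) => //; rewrite i2z.
    have tq1 : t.-1 \in t.+1 :: q1.
      have -> : q1 = qa ++ take (size q1 - size qa) X.
        have := congr1 (take (size q1)) eq.
        by rewrite take_cat ltnNge (ltnW gts) /= => ->; rewrite take_size_cat.
      have := gts; rewrite -subn_gt0; case: (_ - _) => // k _.
      by rewrite inE mem_cat eX /= inE eqxx !orbT.
    by rewrite ez -cat_cons index_cat tq1 /=; rewrite -index_mem in tq1.
  (* The letter t+2 has kept its place, so z differs from z0 in the shuffle of Q1 and X, and t-1 has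
     moved to the left. *)
  + have /andP[/eqP eqa /eqP eX] : (qa == q1) && (X == q2).
      by rewrite -eqseq_cat ?eq.
    subst q1 q2; case: XP => [[_ eX]|[at' [Q2 eX]]].
      by move: z'P nz; rewrite eX shufr0 inE ez /z0 eX cats0 => /eqP->;
        rewrite eqxx.
    move: (z'P); rewrite eX => /shufC_mem/shuf_split.
    case=> Q11 [[|e Q12] [z2 [eQ ez' z2P]]].
      case/negP: nz; rewrite ez ez' /z0 eX eQ cats0.
      by move: z2P; rewrite shufr0 inE => /eqP->.
    apply: (IHn' _ _ _ tz decz ltz); first by rewrite i2z -i2w.
    have i1w : index t.-1 (t.+1 :: z0) = (size qa + (size Q1).+1).+1.
      have ez0 : t.+1 :: z0 = (t.+1 :: qa ++ t.+2 :: Q1) ++ t.-1 :: Q2.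
        by rewrite /z0 eX /= -catA.
      rewrite ez0 index_pivot /= ?size_cat //.
      by move: uw; rewrite ez0 cat_uniq => /and3P[_ /norP[]].
    have i1z : index t.-1 (t.+1 :: z) = (size qa + (@size nat Q11).+1).+1.
      have ez0 : t.+1 :: z = (t.+1 :: qa ++ t.+2 :: Q11) ++ t.-1 :: z2.
        by rewrite ez ez' /= -catA.
      rewrite ez0 index_pivot /= ?size_cat //.
      by move: (starts_uniq tz); rewrite ez0 cat_uniq => /and3P[_ /norP[]].
    rewrite i1z; rewrite i1w eQ (@size_cat nat) /= in le'.
    move: le'; rewrite ltnS; apply: leq_trans.
    by rewrite ltnS -addnS leq_add2l ltnS addnS ltnS leq_addr.
(* After the exchange t+2 takes the place of t+3 in the right factor, before t. *)
- have tz := root_starts_sw tw z0P t23 (tl X) t23 ir t3q zP.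
  have ord := root_order_sw tw z0P t23 (tl X) t23 ir t3q zP.
  have swx x : x <= t -> sw t.+2 x = x.
    by move=> xt; rewrite swo //; move: xt; clear; lia.
  apply: (G_low _ tz) => // [x y ax xy yt|].
    have xt : x <= t by apply: leq_trans yt; apply: ltnW.
    have ay : a <= y by apply: leq_trans ax _; apply: ltnW.
    rewrite ord !swx //; first exact: dec.
      by apply: inq; rewrite ay.
    by apply: inq; rewrite ax.
  rewrite ord ?swl ?swx //; first by rewrite inE t3q orbT.
  by apply: inq; rewrite at_ leqnn.
Qed.

(** * A letter beyond a+3 standing before a *)

Section Far.

Variable e : nat.
Hypothesis ae : a.+1 < e.
Hypothesis G_near : forall x (w : seq nat), a.+1 < x -> x <= e.+1 ->
  starts a.+1 w -> index x w < index a w -> G w = 0%R.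

(* [root_isolate] applied to the part of the word that starts at e. *)
Lemma G_gamma (w : seq nat) : starts a.+1 w ->
  index e.+2 w < index a w -> index e w < index e.+1 w -> G w = 0%R.
Proof.
have [n le] := ubnP (index e w); elim: n w le => // n IHn w le tw lt lt'.
have ain : lo <= a < lo + m by have := starts_in tw; lia.
have e2in := starts_index_lt tw lt.
case: (ltnP (index e w) (index a w)) => [|lea].
  by apply: G_near => //; lia.
have {}lea : index a w < index e w.
  have : index a w <> index e w by apply: (starts_index_neq tw) => //; lia.
  by move: lea; clear; lia.
have [w0 [ew tl]] : exists w0, w = a.+1 :: w0 /\ a.+1 < nth 0 w0 0.
  by have [l [y [-> tl]]] := starts_cons tw; exists (l :: y).
have ein : e \in w0.
  have : e \in w by rewrite (starts_mem tw); lia.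
  by rewrite ew inE gtn_eqF.
move: ew tl; case/splitPr: {w0} ein => q Q ew tl.
have bef (x : nat) : index x w < index e w -> x \in a.+1 :: q.
  by rewrite ew -cat_cons => /mem_before.
have aq : a \in q by have := bef _ lea; rewrite inE ltn_eqF.
have e2q : e.+2 \in q.
  by have := bef _ (ltn_trans lt lea); rewrite inE gtn_eqF // !ltnS; move: ae;
    clear; lia.
have {}tl : a.+1 < nth 0 q 0 by case: q aq tl {ew bef e2q}.
have uw := starts_uniq tw.
have e1Q : e.+1 \in e :: Q.
  have e1w : e.+1 \in w by rewrite (starts_mem tw); move: e2in ae ain; clear;
    lia.
  have eq : e \notin a.+1 :: q.
    by move: uw; rewrite ew -cat_cons cat_uniq => /and3P[_ /norP[]].
  have ew' : w = (a.+1 :: q) ++ e :: Q by [].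
  apply: (mem_after _ eq); first by rewrite -ew'.
  by rewrite -ew'; apply: ltnW.
set z0 := q ++ e :: Q in ew.
have z0P : z0 \in shuf (e :: Q) q.
  by rewrite /z0 -{2}[q]cats0; apply: mem_shuf_cat; rewrite shufr0 inE.
rewrite ew in tw lt lt' lea uw le *.
apply: (root_isolate (root_perm tw z0P) e1Q e2q) => [|//|z zP nz|z zP].
- by left.
- have tz := root_starts tw z0P ae tl zP.
  have ord := root_order tw z0P ae tl zP.
  have [q1 [q2 [z' [eq ez z'P]]]] := shuf_split zP.
  have uz : uniq ((a.+1 :: q1) ++ e :: z').
    by have := starts_uniq tz; rewrite ez.
  have iz : index e (a.+1 :: z) = (size q1).+1.
    rewrite ez -cat_cons index_pivot //.
    by move: uz; rewrite cat_uniq => /and3P[_ /norP[]].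
  have iw : index e (a.+1 :: z0) = (size q).+1.
    rewrite -cat_cons index_pivot //.
    by move: uw; rewrite -cat_cons cat_uniq => /and3P[_ /norP[]].
  apply: (IHn _ _ tz).
  + case: q2 eq z'P => [|y q2] eq z'P.
      case/negP: nz; rewrite ez /z0 eq cats0.
      by move: z'P; rewrite shufr0 inE => /eqP->.
    rewrite iz; move: le; rewrite iw eq size_cat ltnS; apply: leq_trans.
    by rewrite !ltnS addnS ltnS leq_addr.
  + by rewrite ord // inE ?e2q ?aq orbT.
  + have sub : subseq (e :: Q) (a.+1 :: z).
      by apply: subseq_trans (shuf_subseql zP) (subseq_cons _ _).
    apply: (subseq_index (starts_uniq tz) sub) => //.
    by rewrite /= eqxx; case: eqP => // /n_Sn.
(* After the exchange e+1 takes the place of e+2, before a. *)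
- have ae1 : a.+1 < e.+1 by apply: ltnW.
  have tz := root_starts_sw tw z0P ae tl ae1 e1Q e2q zP.
  have ord := root_order_sw tw z0P ae tl ae1 e1Q e2q zP.
  apply: (G_near _ _ tz (x := e.+1)) => //.
  have sa : sw e.+1 a = a by rewrite swo //; move: ae; clear; lia.
  by rewrite ord ?swl ?sa // inE ?e2q ?aq ?orbT.
Qed.

(* The letters of [j, e] form a peak at j, with decreasing positions
   afterwards: two letters next to the peak can be exchanged, which moves the
   peak to the right until [G_gamma] applies. *)
Lemma G_peak j (w : seq nat) : a.+1 < j -> j <= e -> starts a.+1 w ->
  index e.+2 w < index a w -> index j w < index j.+1 w ->
  (forall x y : nat, j < x -> x < y -> y <= e.+1 -> index y w < index x w) ->
  G w = 0%R.
Proof.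
have [n le] := ubnP (e - j);
  elim: n j w le => // n IHn j w le aj je tw lt up dec.
have e2in := starts_index_lt tw lt; have tin := starts_in tw.
case: (eqVneq j e) => [ej|nej].
  by rewrite ej in up; apply: G_gamma up.
have {nej}je : j < e by rewrite ltn_neqAle nej.
have d2 : index j.+2 w < index j.+1 w by apply: dec; move: je; clear; lia.
have n2 : index j w <> index j.+2 w.
  by apply: (starts_index_neq tw); move: e2in tin je aj; clear; lia.
case: (ltnP (index j w) (index j.+2 w)) => [lt2|ge2].
  have wi : wit j w.
    apply: (starts_wit tw (d := j.+2)); auto.
    - by move: tin aj; clear; lia.
    - by move: e2in je; clear; lia.
    - by rewrite /between lt2 d2.
  apply: (starts_G_sw tw wi); have := starts_sw tw wi.
  rewrite swo; try by move: aj; clear; lia.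
  move=> tw'; apply: (IHn j.+1 _ _ _ _ tw') => //.
  - by move: le je; clear; lia.
  - by apply: ltnW.
  - by rewrite !index_sw !swo //; move: aj je; clear; lia.
  - by rewrite !index_sw swr swo //; clear; lia.
  - move=> x y jx xy ye; rewrite !index_sw !swo //; first apply: dec => //;
    by move: jx xy; clear; lia.
have {ge2}lt2 : index j.+2 w < index j w by move: n2 ge2; clear; lia.
have wi : wit j.+1 w.
  apply: (starts_wit tw (d := j)); auto.
  - by move: tin aj; clear; lia.
  - by move: e2in je; clear; lia.
  - by rewrite /between lt2 up orbT.
apply: (starts_G_sw tw wi); have := starts_sw tw wi.
rewrite swo; try by move: aj; clear; lia.
move=> tw'; apply: (IHn j.+1 _ _ _ _ tw') => //.
- by move: le je; clear; lia.
- by apply: ltnW.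
- by rewrite !index_sw !swo //; move: aj je; clear; lia.
- by rewrite !index_sw swl swr.
- move=> x y jx xy ye; rewrite !index_sw [sw _ y]swo; try by move: jx xy; clear;
    lia.
  have [->|nx] := eqVneq x j.+2; first by rewrite swr; apply: dec => //;
    move: jx xy; clear; lia.
  by rewrite swo //; [apply: dec|]; move: jx xy ye; clear; lia.
Qed.

(* Exchanging i and i+1, with i+2 between them, until [G_star] applies to the
   letters of [a, e]. *)
Lemma G_converge i (w : seq nat) : a <= i -> i < e -> starts e.+1 w ->
  (forall x y : nat, a <= x -> x < y -> y <= e -> x <> i -> y <> i ->
     index y w < index x w) ->
  index i w < index e w -> index e.+2 w < index i w -> G w = 0%R.
Proof.
have [n le] := ubnP (e - i);
  elim: n i w le => // n IHn i w le ai ie tw dec lt lt2.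
have e2in := starts_index_lt tw lt2; have tin := starts_in tw.
have p0 := starts_index tw.
have [ei|ni] := eqVneq e i.+1.
  rewrite ei in tw dec lt lt2 e2in tin p0 ie.
  have p2 : 0 < index i w by apply: leq_ltn_trans lt2.
  have wi : wit i.+1 w.
    apply: (starts_wit tw (d := i)); auto.
    - by move: loa ai; clear; lia.
    - by move: e2in; clear; lia.
    - by rewrite /between p0 p2 lt orbT.
  apply: (starts_G_sw tw wi); have := starts_sw tw wi; rewrite swr => tw'.
  apply: (G_star _ tw') => // [x y ax xy yi|]; rewrite !index_sw; last first.
    by rewrite !swo //; clear; lia.
  rewrite !swo; try by move: xy yi; clear; lia.
  have [->|ny] := eqVneq y i; last by apply: dec; move: ax xy yi ny; clear; lia.
  apply: ltn_trans lt _.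
  by apply: dec; move: ax xy yi (ai); clear; lia.
have {}ie : i.+1 < e by move: ie ni; clear; lia.
have up1 : index e w < index i.+1 w.
  by apply: dec; move: ai ie; clear; lia.
have up2 : index i w < index i.+2 w.
  case: (eqVneq e i.+2) => [<-//|ne]; apply: ltn_trans lt _.
  by apply: dec; move: ai ie ne; clear; lia.
have down2 : index i.+2 w < index i.+1 w.
  by apply: dec; move: ai ie; clear; lia.
have wi : wit i w.
  apply: (starts_wit tw (d := i.+2)); auto.
  - by apply: leq_trans ai.
  - by move: tin ie; clear; lia.
  - by rewrite /between up2 down2.
apply: (starts_G_sw tw wi); have := starts_sw tw wi; rewrite swo;
  try by move: ie; clear; lia.
move=> tw'; apply: (IHn i.+1 _ _ _ _ tw') => //.
- by move: le ie; clear; lia.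
- by apply: ltnW.
- move=> x y ax xy ye nx ny; rewrite !index_sw.
  have [ex|nx'] := eqVneq x i; have [ey|ny'] := eqVneq y i.
  + by move: xy; rewrite ex ey ltnn.
  + by rewrite ex swl swo; [apply: dec|..]; move: ax xy ye nx ny ex ny'; clear;
      lia.
  + rewrite ey swl [sw _ x]swo; [|by move: nx nx'; clear; lia..].
    by apply: dec; move: ax xy ye nx ny ey nx' ie; clear; lia.
  + by rewrite !swo; [apply: dec|..]; move: ax xy ye nx ny nx' ny'; clear; lia.
- by rewrite !index_sw swr swo //; move: ie; clear; lia.
- by rewrite !index_sw swr swo //; move: ie; clear; lia.
Qed.

(* Exchanging j and j+1, with j+2 between them, until the head letter is e+1. *)
Lemma G_raise j (w : seq nat) : a < j -> j <= e.+1 -> starts j w ->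
  (forall x y : nat, a < x -> x < y -> y <= e.+1 -> x <> j -> y <> j ->
     index y w < index x w) ->
  (forall x, a < x <= e.+1 -> x <> j -> index a w < index x w) ->
  index e.+2 w < index a w -> G w = 0%R.
Proof.
have [n le] := ubnP (e.+1 - j);
  elim: n j w le => // n IHn j w le aj je tw dec aft lt.
have e2in := starts_index_lt tw lt; have tin := starts_in tw.
have p0 := starts_index tw.
have [ej|nj] := eqVneq j e.+1.
  rewrite ej in tw dec aft tin p0; apply: (G_converge (leqnn a) _ tw) => //.
  - by move: ae; clear; lia.
  - move=> x y ax xy ye nx ny; apply: dec; move: ax xy ye nx; clear; lia.
  - by apply: aft; move: ae; clear; lia.
have {nj}je : j <= e by move: je nj; clear; lia.
have up2 : 0 < index j.+2 w.
  by rewrite lt0n -p0; apply/eqP/nesym/(starts_index_neq tw tin); clear; lia.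
have down2 : index j.+2 w < index j.+1 w.
  case: (eqVneq j e) => [ej|ne]; last by apply: dec; move: aj je ne; clear; lia.
  by rewrite ej; apply: ltn_trans lt _; apply: aft; move: ej ae; clear; lia.
have wi : wit j w.
  apply: (starts_wit tw (d := j.+2)); auto.
  - by move: tin; clear; lia.
  - by move: e2in je; clear; lia.
  - by rewrite /between p0 up2 down2.
apply: (starts_G_sw tw wi); have := starts_sw tw wi; rewrite swl => tw'.
apply: (IHn j.+1 _ _ _ _ tw') => //.
- by move: le je; clear; lia.
- by apply: ltnW.
- move=> x y ax xy ye nx ny; rewrite !index_sw.
  have [ex|nx'] := eqVneq x j; have [ey|ny'] := eqVneq y j.
  + by move: xy; rewrite ex ey ltnn.
  + by rewrite ex swl swo; [apply: dec|..]; move: ax xy ye nx ny ex ny'; clear;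
      lia.
  + rewrite ey swl [sw _ x]swo; [|by move: nx nx'; clear; lia..].
    by apply: dec; move: ax xy ye nx ny ey nx' je; clear; lia.
  + by rewrite !swo; [apply: dec|..]; move: ax xy ye nx ny nx' ny'; clear; lia.
- move=> x ax nx; rewrite !index_sw [sw _ a]swo; [|by move: aj; clear; lia..].
  have [->|nx'] := eqVneq x j.
    by rewrite swl; apply: aft; move: aj je; clear; lia.
  rewrite swo; [|by move: nx nx'; clear; lia..].
  by apply: aft => //; apply/eqP.
- by rewrite !index_sw !swo //; move: aj je; clear; lia.
Qed.

(** If the letters of [a+2, e+1] are not in decreasing order, let j be the largest with j before
    j+1; above j they decrease, and [G_peak] applies. The search for j runs downwards from e+1, with
    d letters below e+1 already inspected. *)
Lemma G_descending (w : seq nat) : starts a.+1 w -> index e.+2 w < index a w ->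
  ((forall x y : nat, a.+1 < x -> x < y -> y <= e.+1 -> index y w < index x w)
    ->
    G w = 0%R) -> G w = 0%R.
Proof.
move=> tw lt Gdec.
have e2in := starts_index_lt tw lt; have tin := starts_in tw.
suff : forall d, G w = 0%R \/ (forall x y : nat, e.+1 - d <= x ->
    a.+1 < x -> x < y -> y <= e.+1 -> index y w < index x w).
  case/(_ e.+1) => // dec; apply: Gdec => x y ax xy ye; apply: dec => //.
  by rewrite subnn.
elim=> [|d [->|dec]]; [|by left|].
  by right=> x y; clear; lia.
set j := e - d; have [ja|ja] := leqP j a.+1.
  by right=> x y _ ax xy ye; apply: dec => //; move: ja ax; rewrite /j; clear;
    lia.
have dj : d <= e by move: ja; rewrite /j; clear; lia.
case: (ltnP (index j w) (index j.+1 w)) => [up|down].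
  left; apply: (G_peak ja _ tw) => //; first by rewrite /j leq_subr.
  move=> x y jx xy ye; apply: dec => //; move: jx ja; rewrite /j; clear; lia.
have {}down : index j.+1 w < index j w.
  have : index j.+1 w <> index j w.
    by apply: (starts_index_neq tw); move: e2in tin ja; rewrite /j; clear; lia.
  by move: down; clear; lia.
right=> x y jx ax xy ye; have [ex|nx] := eqVneq x j; last first.
  by apply: dec => //; move: jx nx; rewrite /j; clear; lia.
rewrite ex; have [->//|ny] := eqVneq y j.+1; apply: ltn_trans down.
by apply: dec => //; move: xy ny ax ex; rewrite /j; move: dj; clear; lia.
Qed.

End Far.

(** For x = a+2 and x = a+3 these are [G_low] and [G_star]. For x = e+2 beyond them, a letter of
    [a+2, e+1] before a is settled by induction; if there is none, these letters follow a and may be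
    taken in decreasing order, which is the initial position of [G_raise] with j = a+1. *)
Lemma G_far x (w : seq nat) : a.+1 < x -> starts a.+1 w ->
  index x w < index a w -> G w = 0%R.
Proof.
elim/ltn_ind: x w => x IHx w ax tw lt; have tin := starts_in tw.
have chain : decreasing_upto a w by move=> y z; clear; lia.
have [ex|nx] := eqVneq x a.+2; first by rewrite ex in lt; apply: G_low lt.
have [ex|nx'] := eqVneq x a.+3; first by rewrite ex in lt; apply: G_star lt.
case: x => [|[|e]] // in IHx ax lt nx nx' *.
have ae : a.+1 < e by move: ax nx nx'; clear; lia.
have near y (w' : seq nat) : a.+1 < y -> y <= e.+1 -> starts a.+1 w' ->
    index y w' < index a w' -> G w' = 0%R by move=> ay ye; apply: IHx.
case: (boolP (has (fun y => index y w < index a w) (iota a.+2 (e - a)))).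
  case/hasP=> y; rewrite mem_iota => /andP[ay ye]; apply: near => //.
  by move: ye ae; clear; lia.
move/hasPn=> aft; apply: (G_descending ae near tw lt) => dec.
apply: (G_raise ae (ltnSn a) _ tw) => //.
- by move=> y z ay yz ze ny nz; apply: dec => //; move: ay ny; clear; lia.
- move=> y /andP[ay ye] ny.
  have yi : y \in iota a.+2 (e - a).
    by rewrite mem_iota; move: ay ye ny; clear; lia.
  have := aft y yi; rewrite -leqNgt leq_eqVlt => /orP[/eqP e0|//].
  have ain : lo <= a < lo + m by move: tin loa; clear; lia.
  have na : a <> y by move: ay; clear; lia.
  by case: (starts_index_neq tw ain na).
Qed.

End Step.

(** If the word begins with a+1 and a larger letter l, then l, being second, stands before a; so
    [G_far] applies. *)
Lemma G_starts s (w : seq nat) : starts s w -> G w = 0%R.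
Proof.
elim: s w => [|a IHa] w tw; have tin := starts_in tw;
  have [l [y [ew sl]]] := starts_cons tw; case: (tw) => wP _ _.
  have e0 : lo = 0 by move: tin; clear; lia.
  have ew' : w = lo :: l :: y by rewrite ew e0.
  by rewrite ew' in wP *; apply: G_lo.
have [es|ns] := eqVneq lo a.+1; first by move: wP; rewrite ew -es; apply: G_lo.
have loa : lo <= a by move: tin ns; clear; lia.
apply: (G_far loa IHa sl tw).
have il : index l w = 1.
  by rewrite ew /= eqxx; case: eqP => // e; move: sl; rewrite e ltnn.
have ain : lo <= a < lo + m by move: tin loa; clear; lia.
have n1 : index a w <> index l w.
  by apply: (starts_index_neq tw ain); move: sl; clear; lia.
have n2 : index a w <> index a.+1 w.
  by apply: (starts_index_neq tw ain); clear; lia.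
by move: n1 n2; rewrite il (starts_index tw); clear; lia.
Qed.

End Core.

(** * Functions of the descent set *)

Section Flip.

Variables (lo m : nat).

(* The reversal of the interval of letters, extended to an involution of nat. *)
Definition flip x := if lo <= x < lo + m then lo + lo + m.-1 - x else x.

Lemma flipK : involutive flip.
Proof. by move=> x; rewrite /flip; do !case: ifP; lia. Qed.

Lemma index_flip x w : index x (map flip w) = index (flip x) w.
Proof. by rewrite -{1}[x]flipK index_map //; apply: inv_inj flipK. Qed.

(** Reversal turns the pair i, i+1 into a pair whose smaller letter is [flip i.+1]. *)
Lemma flip_sw i x : lo <= i -> i.+1 < lo + m ->
  flip (sw i x) = sw (flip i.+1) (flip x).
Proof. by rewrite /flip /sw; do !(case: ifP || case: eqP); lia. Qed.

Lemma perm_flip w : perm_eq w (iota lo m) -> perm_eq (map flip w) (iota lo m).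
Proof.
move=> wP; have wi := perm_mem wP; have fi := inv_inj flipK.
apply: uniq_perm; rewrite ?iota_uniq ?(map_inj_uniq fi) //.
  by rewrite (perm_uniq wP) iota_uniq.
move=> x; rewrite -{1}[x]flipK (mem_map fi) wi !mem_iota /flip.
by case: ifP; lia.
Qed.

Lemma des_flip w : uniq w -> {in w, forall y, lo <= y < lo + m} ->
  des (map flip w) = map negb (des w).
Proof.
case: w => // x w uw wi; elim: w x wi uw => // y w IHw x wi uw;
  rewrite /= in IHw *.
rewrite IHw => [|z zw|]; last by case/andP: uw.
- congr (_ :: _).
  have := wi x; have := wi y; rewrite !inE !eqxx !orbT /flip => -> // -> //.
  move: uw; rewrite /= inE negb_or => /andP[/andP[xy _] _].
  have := wi x; have := wi y; rewrite !inE !eqxx !orbT => /(_ isT) + /(_ isT).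
  by move: xy; clear; lia.
- by apply: wi; rewrite inE zw orbT.
Qed.

(** Reversing the letters interchanges the two kinds of witnesses, i-1 and i+2. *)
Lemma shuffle_invariant_flip (V : zmodType) (H : seq nat -> V) :
  shuffle_invariant lo m H -> shuffle_invariant lo m (fun w => H (map flip w)).
Proof.
move=> inv i r q pe wi.
have [iw jw [d dP bt]] := wi.
have mem x : (x \in rev r ++ q) = (lo <= x < lo + m).
  by rewrite mem_cat mem_rev -mem_cat (perm_mem pe) mem_iota.
have li : lo <= i by move: iw; rewrite mem => /andP[].
have lj : i.+1 < lo + m by move: jw; rewrite mem => /andP[].
have comm s : map flip (map (sw i) s) = map (sw (flip i.+1)) (map flip s).
  by rewrite -!map_comp; apply: eq_map => x; apply: flip_sw.
have := inv (flip i.+1) (map flip r) (map flip q).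
rewrite -!comm !shuf_map !big_map -map_cat -map_rev -map_cat => -> //.
  exact: perm_flip.
have fi : (flip i.+1).+1 = flip i by rewrite /flip; do !case: ifP; lia.
have dm : lo <= d < lo + m.
  rewrite -mem -index_mem.
  have := index_size i (rev r ++ q); have := index_size i.+1 (rev r ++ q).
  by move: bt; rewrite /between; clear; lia.
split; rewrite ?fi ?mem_map //; try exact: inv_inj flipK.
exists (flip d); last first.
  by rewrite /between !index_flip !flipK; move: bt; rewrite /between orbC.
have jm : lo <= i.+1 < lo + m by rewrite lj (leq_trans li).
have im : lo <= i < lo + m by rewrite li ltnW.
by rewrite /flip dm jm im; move: dP dm jm li; clear; lia.
Qed.

End Flip.

Section DescentTheorem.

Context {V : zmodType}.
Implicit Types (H : seq nat -> V).

Lemma shuffle_invariant_ascent lo m H (k : seq bool -> V) :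
  shuffle_invariant lo m H ->
  (forall y, perm_eq (lo :: y) (iota lo m) -> H (lo :: y) = k (des y)) ->
  forall s l y, s < l -> perm_eq [:: s, l & y] (iota lo m) ->
  H [:: s, l & y] = k (des (l :: y)).
Proof.
move=> inv Hlo s l y sl wP; apply/eqP; rewrite -subr_eq0; apply/eqP.
pose G w := (H w - k (des (behead w)))%R.
apply: (@G_starts _ lo m G) (s) _ _ => //.
- move=> i w wP' wi; rewrite /G (shuffle_invariant_knuth inv wP' wi).
  rewrite behead_map des_sw //.
  have uw : uniq w by rewrite (perm_uniq wP') iota_uniq.
  by case: w uw wi {wP'} => // x w uw /(wit_apart uw)/path_sorted.
- move=> i c r q pe ir jq wi; rewrite /G /= !sumrB.
  have u : uniq (c :: r ++ q) by rewrite (perm_uniq pe) iota_uniq.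
  have pe' : perm_eq (r ++ c :: q) (iota lo m).
    by rewrite (perm_catCA r [:: c] q).
  rewrite (shuffle_invariant_root inv pe' wi) swo; last 2 first.
  + by apply: contraTneq u => ->; rewrite /= mem_cat ir.
  + by apply: contraTneq u => ->; rewrite /= mem_cat jq orbT.
  by rewrite (big_shuf_des _ _ ir jq) //; case/andP: u.
- by move=> y' yP; rewrite /G Hlo // subrr.
Qed.

Theorem shuffle_invariant_des lo m H : shuffle_invariant lo m H ->
  exists k : seq bool -> V, forall w, perm_eq w (iota lo m) -> H w = k (des w).
Proof.
elim: m lo H => [|[_|m IHm]] lo H inv.
- by exists (fun _ => H [::]) => w /perm_nilP->.
- by exists (fun _ => H [:: lo]) => w /perm_small_eq->.
have loP : perm_eq (lo :: iota lo.+1 m.+1) (iota lo m.+2) by [].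
have hiP : perm_eq (lo + m.+1 :: iota lo m.+1) (iota lo m.+2).
  by rewrite -[m.+2]addn1 iotaD -cat1s perm_catC.
have [k1 k1P] := IHm _ _ (shuffle_invariant_cons loP inv).
have [k2 k2P] := IHm _ _ (shuffle_invariant_cons hiP inv).
exists (fun d => if head false d then k2 (behead d) else k1 (behead d)) => w wP.
have sw2 : size w = m.+2 by rewrite (perm_size wP) size_iota.
case: w sw2 wP => [|s [|l y]] // _ wP.
have uw : uniq [:: s, l & y] by rewrite (perm_uniq wP) iota_uniq.
case: (ltngtP s l) => [sl|ls|sl]; last by move: uw; rewrite sl /= inE eqxx.
  rewrite /= ltnNge ltnW //=.
  apply: (shuffle_invariant_ascent inv _ sl wP) => z zP; apply: k1P.
  by rewrite -(perm_cons lo) (perm_trans zP).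
rewrite /= ls.
pose c := flip lo m.+2; pose hi := lo + m.+1.
have cw t : t \in [:: s, l & y] -> lo <= t < lo + m.+2.
  by rewrite (perm_mem wP) mem_iota.
have csl : c s < c l.
  have := cw s; have := cw l; rewrite !inE !eqxx !orbT /c /flip => lm sm.
  by rewrite lm // sm //; move: (lm isT) (sm isT) ls; clear; lia.
have cK : map c [:: c s, c l & map c y] = [:: s, l & y].
  by rewrite /c /= !flipK (mapK (@flipK _ _)).
have inv' := shuffle_invariant_flip inv.
have desc := shuffle_invariant_ascent inv' (k := k2 \o map negb).
(* An initial descent becomes an ascent under reversal, the least letter becomes the greatest, and
   every bit of [des] is negated; hence k2 replaces k1. *)
rewrite -cK desc //; last exact: (perm_flip wP).
  have -> : des (c l :: map c y) = map negb (des (l :: y)).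
    apply: (@des_flip lo m.+2 (l :: y)); first by case/andP: uw.
    by move=> t ty; apply: cw; rewrite inE ty orbT.
  by rewrite /= -map_comp map_id_in // => b _; apply: negbK.
move=> z zP.
have chi : c lo = hi by rewrite /c /flip /hi leqnn; case: ifP; lia.
have zc : perm_eq (map c z) (iota lo m.+1).
  rewrite -(perm_cons hi) -chi -[_ :: map c z]/(map c (lo :: z)).
  by apply: perm_trans (perm_flip zP) _; rewrite perm_sym chi.
have zP' : perm_eq z (iota lo.+1 m.+1) by rewrite -(perm_cons lo).
have -> : map c (lo :: z) = hi :: map c z by rewrite /= chi.
rewrite k2P // des_flip //=; first by rewrite (perm_uniq zP') iota_uniq.
by move=> t; rewrite (perm_mem zP') mem_iota; clear; lia.
Qed.

End DescentTheorem.

(** * Row insertion and dual Knuth moves *)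

(** The last row comes first, so a letter bumped to the front of its row stands right after the rows
    it has yet to enter. *)
Definition row_word (t : seq (seq nat)) : seq nat := flatten (rev t).

Lemma row_word_cons r t : row_word (r :: t) = row_word t ++ r.
Proof. by rewrite /row_word rev_cons flatten_rcons. Qed.

Lemma row_insert_rcons r t x : all (leq^~ x) r ->
  row_insert (r :: t) x = (rcons r x :: t, 0).
Proof.
move=> rx /=; rewrite -has_find ifN //.
by rewrite -all_predC; apply: sub_all rx => y /=; rewrite leqNgt.
Qed.

Lemma row_insert_bump u y v t x : all (leq^~ x) u -> x < y ->
  row_insert ((u ++ y :: v) :: t) x =
  ((u ++ x :: v) :: (row_insert t y).1, (row_insert t y).2.+1).
Proof.
move=> ux xy /=.
have -> : find (fun z => x < z) (u ++ y :: v) = size u.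
  elim: u ux => [|z u IHu] /=; first by rewrite xy.
  by case/andP; rewrite leqNgt => /negPf-> /IHu->.
rewrite size_cat /= addnS ltnS leq_addr nth_cat ltnn subnn /=.
by case: row_insert => t' k /=; congr (_ :: _, _); elim: u {ux} => //= z u ->.
Qed.

Lemma row_insertP r x : all (leq^~ x) r \/
  exists u y v, [/\ r = u ++ y :: v, all (leq^~ x) u & x < y].
Proof.
elim: r => [|z r IHr]; first by left.
have [zx|xz] := leqP z x; last by right; exists [::], z, r.
by case: IHr => [rx|[u [y [v [-> ux xy]]]]];
  [left; rewrite /= zx|right; exists (z :: u), y, v; rewrite /= zx].
Qed.

Lemma row_insert_perm t x :
  perm_eq (row_word (row_insert t x).1) (x :: row_word t).
Proof.
elim: t x => [|r t IHt] x; first by [].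
case: (row_insertP r x) => [rx|[u [y [v [-> ux xy]]]]].
  rewrite row_insert_rcons //= !row_word_cons -cats1 catA.
  by rewrite -[x :: _]/([:: x] ++ _) perm_catC.
rewrite row_insert_bump //= !row_word_cons.
rewrite (perm_trans (perm_cat (IHt y) (perm_refl _))) //=.
apply/seq.permP => a; do !rewrite /= ?count_cat; lia.
Qed.

Lemma all_leq_ltn (x : nat) (u : seq nat) :
  x \notin u -> all (leq^~ x) u -> all (ltn^~ x) u.
Proof.
move=> xu /allP ux; apply/allP => z zu /=; rewrite ltn_neqAle ux // andbT.
by apply: contraNneq xu => <-.
Qed.

Lemma sorted_ltn_cat (u v : seq nat) y : sorted ltn (u ++ y :: v) =
  [&& all (ltn^~ y) u, all (ltn y) v, allrel ltn u v, sorted ltn u & sorted ltn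
    v].
Proof.
rewrite !(sorted_pairwise ltn_trans) pairwise_cat allrel_consr pairwise_cons.
by apply/and3P/and5P => [[/andP[-> ->] -> /andP[-> ->]]|[-> -> -> -> ->]].
Qed.

Lemma sorted_bump (u v : seq nat) x y : all (ltn^~ x) u -> x < y ->
  sorted ltn (u ++ y :: v) -> sorted ltn (u ++ x :: v).
Proof.
move=> ux xy; rewrite !sorted_ltn_cat ux => /and3P[_ /allP yv ->].
by rewrite andbT; apply/allP => z /yv; apply: ltn_trans.
Qed.

Lemma row_insert_sorted t x : uniq (x :: row_word t) -> all (sorted ltn) t ->
  all (sorted ltn) (row_insert t x).1.
Proof.
elim: t x => [|r t IHt] x //; rewrite row_word_cons => un.
rewrite [all _ (_ :: _)]/= => /andP[sr st].
have := row_insertP r x => -[rx|[u [y [v [er ux xy]]]]].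
  rewrite row_insert_rcons //= st andbT -cats1 sorted_ltn_cat sr /= !andbT.
  rewrite all_leq_ltn //=; last by move: un;
    rewrite /= mem_cat negb_or -andbA => /and3P[].
  by apply/allrelP.
rewrite er row_insert_bump //= IHt //.
  rewrite andbT; apply: (sorted_bump _ xy); last by rewrite -er.
  apply: all_leq_ltn ux; move: un; rewrite er /= !mem_cat !negb_or.
  by case/andP=> /and3P[].
move: un; rewrite er /= !mem_cat inE !negb_or !cat_uniq => /and3P[_ ut].
by case/andP=> /hasPn/(_ y) yt _; rewrite ut yt // mem_cat inE eqxx orbT.
Qed.

(** * Parallel insertion of two words that differ by an exchange *)

Lemma sw_ltE j x y : ~~ ((x == j) && (y == j.+1) || (x == j.+1) && (y == j)) ->
  (sw j x < sw j y) = (x < y).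
Proof. by rewrite /sw; do !case: eqP; lia. Qed.

(* The case in which the insertions of x into r and of [sw j x] into
   [map (sw j) r] may bump letters at different places. *)
Definition clashing j x (r : seq nat) :=
  (x == j) && (j.+1 \in r) || (x == j.+1) && (j \in r).

Lemma sw_all j x r : ~~ clashing j x r ->
  all (leq^~ (sw j x)) (map (sw j) r) = all (leq^~ x) r.
Proof.
move=> nc; rewrite all_map; apply: eq_in_all => y yr /=.
rewrite leqNgt sw_ltE; first by rewrite -leqNgt.
apply: contra nc => /orP[] /andP[ex /eqP ey];
by rewrite /clashing ex -ey yr ?orbT.
Qed.

(** In a bump y jumps to the left over u, and x over v; no other pair of letters changes its
    order. *)
Lemma bump_order (A u v D : seq nat) (x y p q : nat) :
  let W := A ++ (u ++ y :: v) ++ x :: D in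
  uniq W -> (p \in u -> q <> y) -> (p \in v -> q <> x) ->
  index p W < index q W ->
  index p (A ++ y :: (u ++ x :: v) ++ D) < index q (A ++ y :: (u ++ x :: v) ++
    D).
Proof.
move=> W uW pu pv.
have : uniq [:: x, y & A ++ u ++ v ++ D].
  rewrite -(perm_uniq (_ : perm_eq W _)) //; apply/seq.permP => a.
  by rewrite /W /=; do !rewrite /= ?count_cat; lia.
rewrite /= inE !mem_cat !negb_or => /and3P[].
move=> /and5P[xy _ xu xv _] /and4P[_ yu yv _] _ {uW}.
(* For z outside A, [a z] and [b z] are its positions behind A before and after the bump. *)
pose a (z : nat) := if z \in u then index z u else size u + (if z == y then 0
  else
  (if z \in v then index z v else size v + (if z == x then 0 else
  (index z D).+1)).+1).
pose b (z : nat) := if z == y then 0 else (if z \in u then index z u else size u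
  +
  (if z == x then 0 else (if z \in v then index z v else size v +
  index z D).+1)).+1.
have cls (z : nat) : [\/ [/\ z = y, a z = size u & b z = 0],
    [/\ z = x, a z = (size u + size v).+1 & b z = (size u).+1],
    [/\ z \in u, a z < size u & b z = (a z).+1] |
    [/\ z \in v, size u < a z <= size u + size v & b z = (a z).+1] \/
    (size u + size v).+1 < a z /\ b z = a z].
  rewrite /a /b; case: (boolP (z \in u)) => zu.
    have zy : z != y by apply: contraNneq yu => <-.
    by constructor 3; rewrite (negPf zy) index_mem.
  have [zy|_] := eqVneq z y; first by constructor 1; rewrite addn0.
  case: (boolP (z \in v)) => zv.
    have zx : z != x by apply: contraNneq xv => <-.
    constructor 4; left; rewrite (negPf zx) addnS; split=> //.
    have : index z v < size v by rewrite index_mem.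
    by clear; lia.
  have [zx|_] := eqVneq z x; first by constructor 2; split=> //; clear; lia.
  by constructor 4; right; clear; lia.
have iW (z : nat) : index z W = if z \in A then index z A else size A + a z.
  by rewrite /W index_cat -catA index_cat cat_cons /= index_cat /= ![_ ==
    z]eq_sym.
have iW' (z : nat) : index z (A ++ y :: (u ++ x :: v) ++ D) =
    if z \in A then index z A else size A + b z.
  by rewrite index_cat /= -catA index_cat cat_cons /= index_cat ![_ == z]eq_sym.
rewrite !iW !iW' {iW iW'}.
have [pA|pA] := boolP (p \in A); have [qA|qA] := boolP (q \in A) => //.
- move=> _; rewrite -index_mem in pA; apply: leq_trans pA (leq_addr _ _).
- rewrite -index_mem in qA => lt; have := ltn_trans lt qA.
  by rewrite ltnNge leq_addr.
rewrite !ltn_add2l.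
have := cls p; have := cls q; move: (a p) (b p) (a q) (b q) => ap bp aq bq.
clear cls a b xy xu xv yu yv pA qA W.
case=> [[qy -> ->]|[qx -> ->]|[qu ? ->]|[[qv ? ->]|[? ->]]];
case=> [[py -> ->]|[px -> ->]|[zu ? ->]|[[zv ? ->]|[? ->]]]; 
  by [clear pu pv; lia | case: (pu zu) | case: (pv zv)].
Qed.

(** A pair that changes order has a third letter strictly between its values: x between u and y, or
    y between x and v. Two letters of the witness differ by at most 2, so such a pair would produce
    a clash or contradict the order within the row. *)
Lemma wit_bump (j : nat) (A u v D : seq nat) (x y : nat) :
  uniq (A ++ (u ++ y :: v) ++ x :: D) ->
  all (ltn^~ x) u -> x < y -> all (ltn y) v -> ~~ clashing j x (u ++ y :: v) ->
  wit j (A ++ (u ++ y :: v) ++ x :: D) ->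
  wit j (A ++ y :: (u ++ x :: v) ++ D).
Proof.
set W := A ++ _; set W' := A ++ _ => uW ux xy vy nc [jW j1W [d dP bt]].
have mW z : (z \in W') = (z \in W).
  rewrite /W /W' !(mem_cat, inE); do !case: (z \in _); rewrite ?orbT //=;
  by case: (z == y); case: (z == x).
split; rewrite ?mW //; exists d => //.
have ord (p q : nat) : index p W < index q W ->
    (p \in u -> q <> y) -> (p \in v -> q <> x) -> index p W' < index q W'.
  by move=> lt pu pv; apply: bump_order.
have yv z : z \in v -> index y W < index z W.
  move=> zv; have /= yz := allP vy z zv; rewrite ltn_neqAle in yz.
  case/andP: yz => yz _.
  apply: (@subseq_index _ _ (y :: v)) => //.
  - rewrite /W -catA; apply: subseq_trans (suffix_subseq A _).
    by apply: subseq_trans (suffix_subseq u _); apply: prefix_subseq.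
  - by rewrite inE zv orbT.
  - by rewrite /= eqxx (negPf yz).
have xj z : z \in u ++ y :: v -> ~ (x = j /\ z = j.+1) /\ ~ (x = j.+1 /\ z = j).
  by move=> zr; split=> -[ex ez]; case/negP: nc;
    rewrite /clashing ex -ez zr !eqxx ?orbT.
have ux' z : z \in u -> z < x by apply: (allP ux).
have vy' z : z \in v -> y < z by apply: (allP vy).
have xu z : z \in u -> ~ (x = j /\ z = j.+1) /\ ~ (x = j.+1 /\ z = j).
  by move=> zu; apply: xj; rewrite mem_cat zu.
have xy' := xj y; rewrite mem_cat inE eqxx orbT in xy'.
have {}xy' := xy' isT.
rewrite /between; case/orP: bt => /andP[l1 l2]; apply/orP; [left|right].
  apply/andP; split; apply: ord => // zs e.
  - by have := ux' _ zs; have := xu _ zs; move: xy e dP; clear; lia.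
  - by have := vy' _ zs; move: xy e dP; clear; lia.
  - by have := ux' _ zs; move: xy xy' e dP; clear; lia.
  - by have := vy' _ zs; move: xy e dP; clear; lia.
apply/andP; split; apply: ord => // zs e.
- by have := ux' _ zs; move: xy e dP; clear; lia.
- have := vy' _ zs; have := yv _ zs; case: (eqVneq y j) => [ey|ny].
    by rewrite ey; move: l1 l2; clear; lia.
  by move: xy ny e dP; clear; lia.
- by have := ux' _ zs; move: xy e dP; clear; lia.
- by have := vy' _ zs; move: xy xy' e dP; clear; lia.
Qed.

Lemma map_sw_id (j : nat) (s : seq nat) :
  j \notin s -> j.+1 \notin s -> map (sw j) s = s.
Proof.
move=> js j1s; apply: map_id_in => x xs; apply: swo.
  by apply: contraNneq js => <-.
by apply: contraNneq j1s => <-.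
Qed.

Lemma bump_perm (A u v D : seq nat) x y :
  perm_eq (A ++ y :: (u ++ x :: v) ++ D) (A ++ (u ++ y :: v) ++ x :: D).
Proof. by apply/seq.permP => a; do !rewrite /= ?count_cat; lia. Qed.

(** Between z and x there is only the rest of the increasing row. *)
Lemma mem_row_between (A r D : seq nat) (x z d : nat) :
  uniq (A ++ r ++ x :: D) -> sorted ltn r -> z \in r ->
  index z (A ++ r ++ x :: D) < index d (A ++ r ++ x :: D) ->
  index d (A ++ r ++ x :: D) < index x (A ++ r ++ x :: D) ->
  d \in r /\ z < d.
Proof.
move=> uW sr zr zd dx; have dr : d \in r.
  have : d \in A ++ r by apply: (@mem_before _ _ D _ x); rewrite -catA.
  rewrite mem_cat => /orP[dA|//]; move: zd.
  have zA : z \notin A.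
    apply/negP => zA; move: uW; rewrite cat_uniq => /and3P[_ /hasPn/(_ z)].
    by rewrite mem_cat zr zA => /(_ isT).
  rewrite !(index_cat _ A) dA (negPf zA); move: dA; rewrite -index_mem.
  by move=> lt lt'; have := ltn_trans lt' lt; rewrite ltnNge leq_addr.
split=> //; apply: (sorted_ltn_index ltn_trans sr) => //.
rewrite (subseq_order uW _ zr dr) //.
by apply: subseq_trans (suffix_subseq A _); apply: prefix_subseq.
Qed.

Lemma row_before (A r D : seq nat) (x z : nat) :
  uniq (A ++ r ++ x :: D) -> z \in r ->
  index z (A ++ r ++ x :: D) < index x (A ++ r ++ x :: D).
Proof.
rewrite !catA => uW zr; have xAr : x \notin A ++ r.
  by move: uW; rewrite cat_uniq => /and3P[_ /hasPn h _]; apply: h;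
    rewrite inE eqxx.
have zAr : z \in A ++ r by rewrite mem_cat zr orbT.
by rewrite index_pivot // index_cat zAr index_mem.
Qed.

Lemma wit3 (j : nat) :
  wit j.+1 [:: j.+1; j; j.+2] /\ wit j.+1 [:: j.+2; j; j.+1].
Proof.
by split; split; rewrite ?inE ?eqxx ?orbT //; exists j; auto;
  rewrite /between /=; do !case: eqP => //=; clear; lia.
Qed.

(** Without a clash j' = j. If x = j and j+1 is in the row, the witness can only be j+2, also in the
    row. Inserting j into u, j+1, j+2, v gives u, j, j+2, v and bumps j+1; inserting j+1 into u, j,
    j+2, v gives u, j, j+1, v and bumps j+2. The results differ by an exchange of j+1 and j+2 with
    witness j. The other clash is the same with the two insertions interchanged. The letters j, j+1,
    j+2 are then outside A and D, which both exchanges fix. *)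
Lemma row_bump_sw (j : nat) (A u v D : seq nat) (x y : nat) :
  uniq (A ++ (u ++ y :: v) ++ x :: D) -> sorted ltn (u ++ y :: v) ->
  all (ltn^~ x) u -> x < y -> wit j (A ++ (u ++ y :: v) ++ x :: D) ->
  exists j' u' v',
    [/\ map (sw j) (u ++ y :: v) = u' ++ sw j' y :: v',
        all (leq^~ (sw j x)) u', sw j x < sw j' y &
        u' ++ sw j x :: v' = map (sw j') (u ++ x :: v)] /\
    [/\ wit j' (A ++ y :: (u ++ x :: v) ++ D),
        map (sw j') A = map (sw j) A & map (sw j') D = map (sw j) D].
Proof.
move=> uW sr ux xy wj; have [nc|] := boolP (~~ clashing j x (u ++ y :: v)).
  exists j, (map (sw j) u), (map (sw j) v); split; split => //.
  - by rewrite map_cat.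
  - rewrite sw_all; first by apply: sub_all ux => z; apply: ltnW.
    by apply: contra nc => /orP[] /andP[xj zu];
      rewrite /clashing xj !mem_cat zu ?orbT.
  - rewrite sw_ltE //; apply: contra nc.
    by case/orP=> /andP[xj yj];
      rewrite /clashing xj -(eqP yj) !mem_cat !inE eqxx !orbT.
  - by rewrite map_cat.
  - apply: wit_bump => //.
    by move: sr; rewrite sorted_ltn_cat => /and3P[_ yv _].
have uW' := perm_uniq (bump_perm A u v D x y); rewrite uW in uW'.
have := sr; rewrite sorted_ltn_cat => /and5P[uy yv uv su sv].
case: wj => _ _ [d dP bt].
have [uA uB] : {in (u ++ y :: v) ++ x :: D, forall z, z \notin A} /\
    {in x :: D, forall z, z \notin u ++ y :: v}.
  move: uW; rewrite cat_uniq => /and3P[_ /hasPn hA].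
  by rewrite cat_uniq => /and3P[_ /hasPn hB _].
have dis z : z \in u ++ y :: v -> z \notin A /\ z \notin D.
  move=> zr; split; first by apply: uA; rewrite mem_cat zr.
  by apply/negP => zD; have := uB z; rewrite inE zD zr orbT => /(_ isT).
have xA : x \notin A by apply: uA; rewrite mem_cat inE eqxx orbT.
have xD : x \notin D.
  by have := uW; rewrite catA cat_uniq /= => /and3P[_ _ /andP[]].
have ltu z : z \in u -> z < x := allP ux z.
have ltv z : z \in v -> y < z := allP yv z.
rewrite negbK => /orP[] /andP[/eqP ex jr].
- have ey : y = j.+1.
    have := jr; rewrite mem_cat inE => /or3P[/ltu|/eqP->//|/ltv].
      by rewrite ex; clear; lia.
    by move: xy; rewrite ex; clear; lia.
  have xlast := row_before uW jr.
  have [dr jd] : d \in u ++ y :: v /\ j.+1 < d.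
    apply: (mem_row_between uW) => //;
    by move: bt xlast; rewrite /between ex; clear; lia.
  have ed : d = j.+2 by move: dP jd; clear; lia.
  have dv : d \in v.
    by have := dr; rewrite mem_cat inE => /or3P[/ltu|/eqP|//]; move: jd ex ey;
      clear; lia.
  have [v0 ev] : exists v0, v = j.+2 :: v0.
    case: v dv sv ltv {uW sr bt uW' yv uv uA uB dis jr xlast dr} => // h v0 dv
      sv ltv.
    exists v0; congr (_ :: _); have := ltv h; rewrite inE eqxx => /(_ isT) yh.
    move: dv; rewrite inE => /orP[/eqP<-//|dv0].
    have /allP/(_ d dv0) : all (ltn h) v0.
      exact: order_path_min ltn_trans sv.
    by move: yh ed ey => /=; clear; lia.
  subst x y v.
  have fu : map (sw j) u = u /\ map (sw j.+1) u = u.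
    have nu z : j <= z -> z \notin u.
      by move=> jz; apply/negP => /ltu; rewrite ltnNge jz.
    by rewrite !map_sw_id ?nu ?nv //; clear; lia.
  have fv : map (sw j) v0 = v0 /\ map (sw j.+1) v0 = v0.
    have nv z : z <= j.+2 -> z \notin v0.
      move=> jz; apply/negP => zv.
      have /allP/(_ z zv) : all (ltn j.+2) v0 by apply: order_path_min ltn_trans
        sv.
      by rewrite /= ltnNge jz.
    by rewrite !map_sw_id ?nu ?nv //; clear; lia.
  have jj : sw j j.+2 = j.+2 by rewrite swo; clear; lia.
  have jj' : sw j.+1 j = j by rewrite swo; clear; lia.
  have [jA jD] := dis _ jr; have [j2A j2D] := dis _ dr; rewrite ed in j2A j2D.
  exists j.+1, (rcons u j), v0; split; split.
  + by rewrite map_cat /= fu.1 fv.1 jj swr swl cat_rcons.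
  + rewrite swl all_rcons leqnSn /=; apply: sub_all ux => z /=; clear; lia.
  + by rewrite !swl.
  + by rewrite map_cat /= fu.2 fv.2 jj' swl swr cat_rcons.
  + apply: (@wit_subseq _ _ [:: j.+1; j; j.+2]) => //.
      apply: subseq_trans (suffix_subseq A _);
        rewrite -cat1s -[in X in subseq _ X]cat1s.
      apply: cat_subseq => //; rewrite -catA;
        apply: subseq_trans (suffix_subseq u _).
      by rewrite /= !eqxx sub0seq.
    exact: (wit3 j).1.
  + by rewrite !map_sw_id.
  + by rewrite !map_sw_id.
have ju : j \in u.
  have := jr; rewrite mem_cat inE => /or3P[//|/eqP|/ltv]; move: xy; rewrite ex;
  by clear; lia.
have [dr jd] : d \in u ++ y :: v /\ j < d.
  have xlast := row_before uW jr.
  by apply: (mem_row_between uW) => //; move: bt xlast; rewrite /between ex;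
    clear; lia.
have ed : d = j.+2 by move: dP jd; clear; lia.
have ey : y = j.+2.
  have := dr; rewrite mem_cat inE => /or3P[/ltu|/eqP|/ltv]; move: xy;
    rewrite ex ed;
  by clear; lia.
have [u0 eu] : exists u0, u = rcons u0 j.
  case/lastP: u ju su ltu {uW sr bt uW' uy uv uA uB dis jr dr ux} => // u0 h ju
    su ltu.
  exists u0; congr (rcons _ _).
  have := ltu h; rewrite mem_rcons inE eqxx ex => /(_ isT) hj.
  move: ju; rewrite mem_rcons inE => /orP[/eqP//|ju0].
  move: su; rewrite -cats1 sorted_ltn_cat => /andP[/allP/(_ j ju0) /= jh _].
  by move: hj jh; clear; lia.
subst x y u.
have lt0 z : z \in u0 -> z < j.
  by move: su; rewrite -cats1 sorted_ltn_cat => /andP[/allP h _] /h.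
have fu : map (sw j) u0 = u0 /\ map (sw j.+1) u0 = u0.
  have nu z : j <= z -> z \notin u0.
    by move=> jz; apply/negP => /lt0; rewrite ltnNge jz.
  by rewrite !map_sw_id ?nu //; clear; lia.
have fv : map (sw j) v = v /\ map (sw j.+1) v = v.
  have nv z : z <= j.+2 -> z \notin v.
    by move=> jz; apply/negP => /ltv; rewrite ltnNge jz.
  by rewrite !map_sw_id ?nv //; clear; lia.
have jj : sw j j.+2 = j.+2 by rewrite swo; clear; lia.
have jj' : sw j.+1 j = j by rewrite swo; clear; lia.
have [jA jD] := dis _ jr; have [j2A j2D] := dis _ dr; rewrite ed in j2A j2D.
exists j.+1, u0, (j.+2 :: v); split; split.
+ by rewrite map_cat map_rcons /= fu.1 fv.1 jj swl swr cat_rcons.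
+ by rewrite swr; apply/allP => z /lt0; apply: ltnW.
+ by rewrite !swr.
+ by rewrite map_cat map_rcons /= fu.2 fv.2 jj' swr swl cat_rcons.
+ apply: (@wit_subseq _ _ [:: j.+2; j; j.+1]) => //.
    apply: subseq_trans (suffix_subseq A _);
      rewrite -cat1s -[in X in subseq _ X]cat1s.
    apply: cat_subseq => //; rewrite cat_rcons -catA.
    apply: subseq_trans (suffix_subseq u0 _).
    by rewrite /= !eqxx sub0seq.
  exact: (wit3 j).2.
+ by rewrite !map_sw_id.
+ by rewrite !map_sw_id.
Qed.

(* The word of an insertion in progress consists of the rows still to be
   visited, the letter x being inserted, and D: the finished rows and the
   letters to come. The two insertions run in parallel on words that differ by an
   exchange of j and j+1; when these two letters meet in a row, j becomes j+1
   ([row_bump_sw]). *)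
Lemma row_insert_sw t x j D : all (sorted ltn) t ->
  uniq (row_word t ++ x :: D) -> wit j (row_word t ++ x :: D) ->
  exists j', [/\ row_insert (map (map (sw j)) t) (sw j x) =
      (map (map (sw j')) (row_insert t x).1, (row_insert t x).2),
    wit j' (row_word (row_insert t x).1 ++ D) &
    map (sw j') D = map (sw j) D].
Proof.
elim: t x j D => [|r t IHt] x j D; first by move=> _ _ wj; exists j.
rewrite row_word_cons -catA => /= /andP[sr st] uW wj.
have xr : x \notin r.
  move: uW; rewrite cat_uniq => /and3P[_ _]; rewrite cat_uniq.
  by case/and3P=> _ /hasPn h _; apply: h; rewrite inE eqxx.
rewrite -/(row_insert (r :: t) x) -/(row_insert (map (sw j) r :: _) (sw j x)).
have [rx|[u [y [v [er ux xy]]]]] := row_insertP r x.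
  exists j; rewrite !row_insert_rcons //=.
    by split; rewrite ?map_rcons // row_word_cons -cats1 -!catA.
  rewrite sw_all //; apply/negP; case: wj => _ _ [d dP bt].
  case/orP=> /andP[/eqP ex jr].
    by have := allP rx _ jr; rewrite /= ex ltnn.
  have xlast := row_before uW jr.
  have [dr jd] : d \in r /\ j < d.
    by apply: (mem_row_between uW) => //; move: bt xlast; rewrite /between ex;
      clear; lia.
  by have /= := allP rx _ dr; move: dP jd; rewrite ex; clear; lia.
rewrite er in sr uW wj xr *.
have {}ux : all (ltn^~ x) u.
  by apply: all_leq_ltn ux; move: xr; rewrite mem_cat => /norP[].
have [j1 [u' [v' [[e1 ux' xy' e2] [w1 eA eD]]]]] := row_bump_sw uW sr ux xy wj.
have uW' : uniq (row_word t ++ y :: (u ++ x :: v) ++ D).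
  by rewrite (perm_uniq (bump_perm _ _ _ _ _ _)).
have [j2 [e3 w2 eD2]] := IHt y j1 _ st uW' w1; exists j2.
have {}ux : all (leq^~ x) u by apply: sub_all ux => z; apply: ltnW.
have et : map (map (sw j)) t = map (map (sw j1)) t.
  apply/eq_in_map => s sP; apply/eq_in_map => z zs.
  have zt : z \in row_word t by apply/flattenP; exists s; rewrite ?mem_rev.
  by move/eq_in_map: eA => ->.
move: eD2; rewrite !map_cat => /eqP; rewrite eqseq_cat ?size_cat ?size_map //.
rewrite -!map_cat => /andP[/eqP eu /eqP eD2].
rewrite e1 et !row_insert_bump //= e3 e2 eu; split=> //; last by rewrite eD2.
by rewrite row_word_cons -catA.
Qed.

(** Each insertion may replace j by j', so j varies in the induction. The new cells lie in the same
    rows, whence equal recording tableaux. *)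
Lemma schensted_step_sw w ls t s j : all (sorted ltn) t ->
  uniq (row_word t ++ w) -> wit j (row_word t ++ w) ->
  (foldl schensted_step (map (map (sw j)) t, s) (zip ls (map (sw j) w))).2 =
  (foldl schensted_step (t, s) (zip ls w)).2.
Proof.
elim: w ls t s j => [|x w IHw] [|l ls] t s j st uW wj //=.
have [j' [e w' ew]] := row_insert_sw st uW wj.
have ut : uniq (x :: row_word t).
  have : subseq (row_word t ++ [:: x]) (row_word t ++ x :: w).
    by rewrite cat_subseq //= eqxx sub0seq.
  by move=> /subseq_uniq/(_ uW); rewrite uniq_catC.
have uW' : uniq (row_word (row_insert t x).1 ++ w).
  rewrite -(perm_uniq (_ : perm_eq (row_word t ++ x :: w) _)) //.
  rewrite -cat_rcons perm_cat2r perm_sym (perm_trans (row_insert_perm t x)) //.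
  by rewrite perm_sym perm_rcons.
have := IHw ls (row_insert t x).1 (add_cell s (row_insert t x).2 l) j'.
rewrite -ew /schensted_step /= e;
  case: row_insert (row_insert_sorted ut st) uW' w' => P k /=.
by move=> sP uP wP; apply.
Qed.

Theorem schensted_sw i w : uniq w -> wit i w ->
  (schensted (map (sw i) w)).2 = (schensted w).2.
Proof.
move=> uw wi; rewrite /schensted size_map.
exact: (@schensted_step_sw w (iota 1 (size w)) [::] [::] i).
Qed.

(** * Lie elements vanish on shuffles *)

(** The coefficients of [omega], read from the front and without reference to a least letter, so
    that they make sense for words in any letters. *)
Fixpoint valley_sign (w : seq nat) : int :=
  if w is x :: t then
    if t is y :: _ then
      if (y < x)%N then (- valley_sign t)%R else ((sorted ltn w)%:R)%R
    else 1%R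
  else 0%R.

Lemma valley_sign_cons x y t : valley_sign [:: x, y & t] =
  (if (y < x)%N then - valley_sign (y :: t) else (sorted ltn [:: x, y &
    t])%:R)%R.
Proof. by []. Qed.

Lemma sorted_cons2 (x y : nat) t :
  sorted ltn [:: x, y & t] = (x < y) && sorted ltn (y :: t).
Proof. by []. Qed.

(** Putting a letter in front, the new value depends only on the old value, the old first letter and
    whether the word increases; so a common factor of both persists. *)
Lemma valley_sign_cat (e : int) u x w w' :
  (valley_sign (x :: w) = e * valley_sign (x :: w'))%R ->
  ((sorted ltn (x :: w))%:R = e * (sorted ltn (x :: w'))%:R)%R ->
  (valley_sign (u ++ x :: w) = e * valley_sign (u ++ x :: w'))%R.
Proof.
move=> ev es; suff : (valley_sign (u ++ x :: w) = e * valley_sign (u ++ x ::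
  w'))%R
  /\ ((sorted ltn (u ++ x :: w))%:R = e * (sorted ltn (u ++ x :: w'))%:R)%R by
    case.
elim: u => [|a u [IHv IHs]] //.
have [b [s [s' [Es Es']]]] : exists b s s', u ++ x :: w = b :: s /\ u ++ x :: w'
  = b :: s'.
  by case: u {IHv IHs} => [|b u];
    [exists x, w, w'|exists b, (u ++ x :: w), (u ++ x :: w')].
rewrite !cat_cons Es Es' in IHv IHs *; rewrite !valley_sign_cons !sorted_cons2.
case: (ltngtP a b) => _ //=; rewrite ?mulrN ?mulr0 -?IHv //.
Qed.

(** Two increasing words without common letters have exactly one increasing shuffle. *)
Lemma big_shuf_sorted c r q : uniq (r ++ q) ->
  (\sum_(z <- shuf r q) (sorted ltn (c :: z))%:R =
   (sorted ltn (c :: r))%:R * (sorted ltn (c :: q))%:R :> int)%R.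
Proof.
elim: r c q => [|x r IHr] c q; first by rewrite big_seq1 mul1r.
elim: q c => [|y q IHq] c u; first by rewrite big_seq1 mulr1.
have u' : uniq ((x :: r) ++ q).
  have : uniq (y :: (x :: r) ++ q).
    by rewrite -(perm_uniq (permEl (perm_catCA (x :: r) [:: y] q))).
  by case/andP.
have xy : x != y.
  by move: u; rewrite /= mem_cat inE !negb_or => /andP[/and3P[]].
rewrite big_shuf_cons.
under eq_bigr do rewrite sorted_cons2 -mulnb natrM.
under [X in (_ + X)%R]eq_bigr do rewrite sorted_cons2 -mulnb natrM.
rewrite -!mulr_sumr IHq // IHr; last by case/andP: u.
rewrite !sorted_cons2; case: (sorted _ (x :: r)); case: (sorted _ (y :: q));
  rewrite ?andbF ?andbT ?mulr0 ?mul0r ?mulr1 ?addr0 //.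
by move: xy; case: (ltngtP x y) => //; case: (ltngtP c x); case: (ltngtP c y);
  lia.
all: by rewrite ?mulr0 ?mul0r.
Qed.

(** A valley word whose tail [x :: w] does not increase must descend all the way to x, one sign per
    letter. *)
Lemma valley_sign_rev r x w : ~~ sorted ltn (x :: w) ->
  (valley_sign (rev r ++ x :: w) =
   (-1) ^+ size r * (sorted ltn (x :: r))%:R * valley_sign (x :: w))%R.
Proof.
elim: r x w => [|z r IHr] x w s; first by rewrite /= expr0 !mul1r.
rewrite rev_cons cat_rcons IHr; last by rewrite sorted_cons2 (negPf s) andbF.
rewrite valley_sign_cons !sorted_cons2 (negPf s) andbF /=.
by case: ltnP => _; rewrite /= ?mulr0 ?mul0r // exprS mulrN mulN1r !mulNr.
Qed.

(** This is the identity that brings a letter of a Lie element to the front, proved directly for the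
    valley coefficients. *)
Lemma big_shuf_valley r c q : uniq (c :: r ++ q) ->
  (\sum_(z <- shuf r q) valley_sign (c :: z) =
   (-1) ^+ size r * valley_sign (rev r ++ c :: q))%R.
Proof.
have [n le] := ubnP (size r + size q); elim: n r c q le => // n IHn r c q le u.
case: r le u => [|x r] le u; first by rewrite big_seq1 mul1r.
have uq : uniq ((x :: r) ++ q) by case/andP: u.
have ur : uniq (x :: r ++ q) := uq.
have cx : c != x by move: u; rewrite /= inE negb_or => /andP[/andP[]].
have IHx : (\sum_(z <- shuf r q) valley_sign (x :: z) =
    (-1) ^+ size r * valley_sign (rev r ++ x :: q))%R by apply: IHn ur.
rewrite [rev (x :: r)]rev_cons cat_rcons [size (x :: r)]/= exprS mulN1r.
case: q => [|y q] in le u uq ur IHx *.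
  move: IHx; rewrite !shufr0 !big_seq1 valley_sign_cons => IHx.
  case: (ltngtP c x) cx => // cx _.
    have s : ~~ sorted ltn [:: x; c] by rewrite /= ltnNge (ltnW cx).
    rewrite (valley_sign_rev _ s) sorted_cons2 cx /= cx mulNr mulrA mulrA.
    by rewrite -expr2 sqrr_sign mul1r mulrN1 opprK.
  have -> : valley_sign (rev r ++ [:: x; c]) = valley_sign (rev r ++ [:: x]).
    rewrite -[RHS]mul1r; apply: valley_sign_cat => /=;
    by rewrite cx ?(ltnNge c) ?(ltnW cx) /= ?mulr1.
  by rewrite IHx mulNr.
have uy : uniq (y :: (x :: r) ++ q).
  by rewrite -(perm_uniq (permEl (perm_catCA (x :: r) [:: y] q))).
have IHy : (\sum_(z <- shuf (x :: r) q) valley_sign (y :: z) =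
    - (-1) ^+ size r * valley_sign (rev r ++ [:: x, y & q]))%R.
  rewrite IHn // ?rev_cons ?cat_rcons /= ?exprS ?mulN1r //.
  by move: le => /=; rewrite !addSn addnS.
have cy : c != y by move: u;
  rewrite /= inE mem_cat inE !negb_or => /andP[/and4P[]].
rewrite big_shuf_cons.
under eq_bigr do rewrite valley_sign_cons.
under [X in (_ + X)%R]eq_bigr do rewrite valley_sign_cons.
(* In [rev r ++ [:: x, c, y & q]] the letter c is a valley, on a descent, on an ascent, or a peak. A
   valley leaves only increasing shuffles; on a descent or an ascent c can be deleted up to sign; at
   a peak the value is zero and the two sums cancel. *)
case: (ltngtP c x) cx => // cx _; case: (ltngtP c y) cy => // cy _.
- have := big_shuf_sorted c uq; rewrite big_shuf_cons => ->.
  have s : ~~ sorted ltn [:: x, c, y & q] by rewrite /= ltnNge (ltnW cx).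
  rewrite (valley_sign_rev _ s) valley_sign_cons cx valley_sign_cons.
  rewrite ltnNge (ltnW cy) [sorted ltn [:: c, x & r]]sorted_cons2 cx /= mulNr.
  by rewrite mulrA mulrA -expr2 sqrr_sign mul1r mulrN opprK.
- under eq_bigr do rewrite sorted_cons2 -mulnb natrM.
  have u1 : uniq (r ++ y :: q) by case/andP: ur.
  rewrite -mulr_sumr (big_shuf_sorted _ u1) sorted_cons2.
  have xy : (x < y) = false by rewrite ltnNge (ltnW (ltn_trans cy cx)).
  rewrite xy /= !mulr0 add0r sumrN IHy mulNr opprK.
  have -> : valley_sign (rev r ++ [:: x, c, y & q]) =
      (-1 * valley_sign (rev r ++ [:: x, y & q]))%R.
    apply: valley_sign_cat.
      by rewrite !valley_sign_cons cx cy (ltn_trans cy cx) mulN1r.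
    by rewrite !sorted_cons2 xy ltnNge (ltnW cx) mulr0.
  by rewrite mulN1r mulrNN.
- under [X in (_ + X)%R]eq_bigr do rewrite sorted_cons2 -mulnb natrM.
  have u1 : uniq ((x :: r) ++ q) by case/andP: uy.
  rewrite -mulr_sumr (big_shuf_sorted _ u1) sorted_cons2.
  have xy : (y < x) = false by rewrite ltnNge (ltnW (ltn_trans cx cy)).
  rewrite xy /= !mul0r mulr0 addr0 sumrN IHx -mulNr.
  have -> : valley_sign (rev r ++ [:: x, c, y & q]) =
      (1 * valley_sign (rev r ++ [:: x, y & q]))%R.
    apply: valley_sign_cat; rewrite mul1r.
      rewrite !valley_sign_cons xy (ltnNge c) (ltnW cx) /=.
      by rewrite cx cy (ltn_trans cx cy).
    by rewrite !sorted_cons2 cx cy (ltn_trans cx cy).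
  by rewrite mul1r.
- rewrite !sumrN IHx IHy mulNr opprK addNr.
  have -> : valley_sign (rev r ++ [:: x, c, y & q]) =
      (0 * valley_sign (rev r ++ [:: x, c, y & q]))%R.
    apply: valley_sign_cat; rewrite mul0r.
      by rewrite !valley_sign_cons !sorted_cons2 (ltnNge c) (ltnW cx) /= (ltnNge
        c y) (ltnW cy) andbF.
    by rewrite !sorted_cons2 (ltnNge c y) (ltnW cy) andbF.
  by rewrite mul0r mulr0.
Qed.

(** The sums below the two possible first letters give the same word [rev r ++ [:: x, y & q]] with
    opposite signs. *)
Lemma shuf_valley_sign r q : uniq (r ++ q) -> r != [::] -> q != [::] ->
  (\sum_(z <- shuf r q) valley_sign z = 0)%R.
Proof.
case: r q => [|x r] [|y q] // u _ _; rewrite big_shuf_cons.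
rewrite !big_shuf_valley //; last 1 first.
  by rewrite -(perm_uniq (permEl (perm_catCA (x :: r) [:: y] q))).
by rewrite rev_cons cat_rcons /= exprS mulN1r mulNr subrr.
Qed.

Lemma valley_signE w : uniq w -> 0 \in w ->
  valley_sign w = (if sorted gtn (take (index 0 w).+1 w)
    && sorted ltn (drop (index 0 w) w) then (-1) ^+ index 0 w else 0)%R.
Proof.
elim: w => [|x t IHt] //.
case: (eqVneq x 0) => [->|x0].
  move=> /andP[ut _] _; rewrite /= take0 /=.
  by case: t ut {IHt} => // y t _ /=; case: ifP.
move=> /andP[xt ut]; rewrite inE eq_sym (negPf x0) => t0.
have -> : index 0 (x :: t) = (index 0 t).+1 by rewrite /= (negPf x0).
case: t xt ut t0 IHt => // y t xt ut t0 /(_ ut t0) E.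
rewrite valley_sign_cons E exprS mulN1r.
have -> : sorted gtn (take (index 0 (y :: t)).+2 [:: x, y & t]) =
   (y < x) && sorted gtn (take (index 0 (y :: t)).+1 (y :: t)) by [].
have -> : drop (index 0 (y :: t)).+1 [:: x, y & t] =
  drop (index 0 (y :: t)) (y :: t) by [].
case: (ltnP y x) => [_|xy].
  by rewrite andTb; case: ifP => _; rewrite ?oppr0.
rewrite andFb; case s: (sorted ltn [:: x, y & t]) => //.
have /allP/(_ 0 t0) : all (ltn x) (y :: t) by apply: order_path_min ltn_trans s.
by [].
Qed.

(** * Coplactic Lie elements *)

Lemma size_word n (p : 'S_n) : size (word p) = n.
Proof. by rewrite size_map size_enum_ord. Qed.

Lemma word_perm n (p : 'S_n) : perm_eq (word p) (iota 0 n).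
Proof.
rewrite -val_enum_ord /word (map_comp val p); apply: perm_map.
apply: uniq_perm; rewrite ?(map_inj_uniq (@perm_inj _ p)) ?enum_uniq // => i.
by rewrite mem_enum -[i](permKV p) map_f // mem_enum.
Qed.

Lemma word_surj n w : perm_eq w (iota 0 n) -> exists p : 'S_n, word p = w.
Proof.
move=> wP; have sw_ : size w = n by rewrite (perm_size wP) size_iota.
have lt (i : 'I_n) : nth 0 w i < n.
  have : nth 0 w i \in w by rewrite mem_nth ?sw_.
  by rewrite (perm_mem wP) mem_iota.
have inj : injective (fun i => Ordinal (lt i)).
  move=> i j [/eqP]; rewrite nth_uniq ?sw_ // => [/eqP/val_inj//|].
  by rewrite (perm_uniq wP) iota_uniq.
exists (perm inj); apply: (@eq_from_nth _ 0); rewrite size_word // => i ilt.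
rewrite (nth_map (Ordinal ilt)) ?size_enum_ord // permE /=.
by rewrite (nth_enum_ord (Ordinal ilt)).
Qed.

Lemma index0_word n (p : 'S_n.+1) : index 0 (word p) = valley_pos p.
Proof.
have -> : 0 = val (p (valley_pos p)) by rewrite permKV.
rewrite /word (index_map (f := fun i => val (p i))) ?index_enum_ord //.
by move=> i j /val_inj/perm_inj.
Qed.

Lemma omega_word n (p : 'S_n.+1) : omega n p = valley_sign (word p).
Proof.
rewrite valley_signE; last first.
- by rewrite (perm_mem (word_perm p)) mem_iota.
- by rewrite (perm_uniq (word_perm p)) iota_uniq.
by rewrite ffunE /valley index0_word.
Qed.

(** * Lie elements as functions on words *)

Section LieWords.

Context {n : nat} (g : {ffun 'S_n.+1 -> int}).
Implicit Types (t : 'S_n.+1) (w r q : seq nat).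

Definition relabel t (a : nat) : nat := t (inord a).

(** If p = s t, the word of s is that of p relabelled by the inverse of t. So right multiplication
    acts on letters only, which commutes with shuffling. *)
Definition lie_sum w : int :=
  (\sum_(t : 'S_n.+1) g t * valley_sign (map (relabel (t^-1)%g) w))%R.

Lemma gmul_omega p : gmul (omega n) g p = lie_sum (word p).
Proof.
rewrite ffunE (exchange_big_dep predT) //=; apply: eq_bigr => t _.
rewrite (big_pred1 (p * t^-1)%g) => [|s]; last first.
  by apply/eqP/eqP => [<-|->]; rewrite ?mulgK ?mulgKV.
rewrite mulrC omega_word; congr (_ * valley_sign _)%R.
by rewrite /word -map_comp; apply: eq_map => i /=;
  rewrite permM /relabel inord_val.
Qed.

Lemma shuf_lie_sum r q : uniq (r ++ q) -> {in r ++ q, forall a, a < n.+1} ->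
  r != [::] -> q != [::] -> (\sum_(z <- shuf r q) lie_sum z = 0)%R.
Proof.
move=> u lt r0 q0; rewrite exchange_big big1 //= => t _; rewrite -mulr_sumr.
rewrite -[X in (_ * X)%R](big_map (map (relabel t^-1%g)) predT valley_sign).
rewrite -shuf_map shuf_valley_sign ?mulr0 -?size_eq0 ?size_map ?size_eq0 //.
rewrite -map_cat map_inj_in_uniq // => a b /lt la /lt lb.
move=> /val_inj/perm_inj/(congr1 val); by rewrite /= !inordK.
Qed.

End LieWords.

Lemma index_rev (w : seq nat) x : uniq w -> x \in w ->
  index x (rev w) = size w - (index x w).+1.
Proof.
move=> u /splitPr ww; case: ww u => p q; rewrite cat_uniq /= negb_or.
case/and3P=> _ /andP[xp _] /andP[xq _].
rewrite rev_cat rev_cons cat_rcons !index_pivot ?mem_rev // size_rev size_cat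
  /=.
by rewrite addnS subSS addKn.
Qed.

Lemma wit_rev i w : uniq w -> wit i (rev w) -> wit i w.
Proof.
move=> u [iw jw [d dP bt]]; rewrite !mem_rev in iw jw; split=> //;
  exists d => //.
have dw : d \in w.
  rewrite -mem_rev -index_mem.
  have := index_size i (rev w); have := index_size i.+1 (rev w).
  by move: bt; rewrite /between; clear; lia.
move: bt; rewrite /between !index_rev //.
have := iw; have := jw; have := dw; rewrite -!index_mem; clear; lia.
Qed.

Lemma coplactic_invariant n (H : seq nat -> int) :
  (forall p s : 'S_n, Qsymbol p = Qsymbol s -> H (word p) = H (word s)) ->
  (forall r q, perm_eq (r ++ q) (iota 0 n) -> r != [::] -> q != [::] ->
     (\sum_(z <- shuf r q) H z = 0)%R) ->
  shuffle_invariant 0 n H.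
Proof.
move=> HQ H0.
have knuth i w : perm_eq w (iota 0 n) -> wit i w -> H w = H (map (sw i) w).
  move=> wP wi; have uw : uniq w by rewrite (perm_uniq wP) iota_uniq.
  have [p ep] := word_surj wP; case: (wi) => iw jw _.
  have [s es] := word_surj (perm_map_sw iw jw wP).
  by have := HQ p s; rewrite /Qsymbol ep es schensted_sw // => ->.
move=> i r q pe wi; have [r0|r0] := eqVneq r [::].
  by rewrite r0 in pe wi *; rewrite !big_seq1; apply: knuth.
have [q0|q0] := eqVneq q [::].
  rewrite q0 !cats0 in pe wi *; rewrite !shufr0 !big_seq1; apply: knuth => //.
  by apply: wit_rev wi; rewrite (perm_uniq pe) iota_uniq.
rewrite H0 // H0 -?size_eq0 ?size_map ?size_eq0 // -map_cat.
case: wi; rewrite !mem_cat !mem_rev -!mem_cat => iw jw _.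
exact: perm_map_sw.
Qed.

Lemma Des_des n (p s : 'S_n) : Des p = Des s -> des (word p) = des (word s).
Proof.
move=> E; have desE (t : 'S_n) : des (word t) =
    [seq nth 0 (word t) i.+1 < nth 0 (word t) i | i <- iota 0 n.-1].
  have <- : (size (word t)).-1 = n.-1 by rewrite size_word.
  rewrite /des; case: (word t) => // x w /=.
  apply: (@eq_from_nth _ false);
    rewrite size_pairmap ?size_map ?size_iota // => i lt.
  by rewrite (nth_pairmap 0) // (nth_map 0) ?size_iota // nth_iota.
rewrite !desE; apply/eq_in_map => i; rewrite mem_iota => /= lt.
by have := congr1 (fun A : {set _} => Ordinal lt \in A) E; rewrite !inE.
Qed.

(** * Integer spans and coefficients *)

Lemma int_span0 (V : zmodType) (G : V -> Prop) : int_span G 0%R.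
Proof. by exists 0, [tuple]; split=> [[]//|]; exists [ffun=> 0%R];
  rewrite big_ord0. Qed.

Lemma int_spanMz (V : zmodType) (G : V -> Prop) v (a : int) :
  G v -> int_span G (v *~ a)%R.
Proof.
move=> Gv; exists 1, [tuple v]; split=> [i|]; first by rewrite ord1.
by exists [ffun=> a]; rewrite big_ord1 ffunE.
Qed.

Lemma int_spanD (V : zmodType) (G : V -> Prop) v w :
  int_span G v -> int_span G w -> int_span G (v + w)%R.
Proof.
move=> [m1 [X1 [G1 [a1 ->]]]] [m2 [X2 [G2 [a2 ->]]]].
exists (m1 + m2), [tuple of X1 ++ X2]; split=> [i|].
  by case: (split_ordP i) => j ->; rewrite ?tnth_lshift ?tnth_rshift.
exists [ffun i => match split i with inl j => a1 j | inr j => a2 j end].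
rewrite big_split_ord /=; congr (_ + _)%R; apply: eq_bigr => i _; rewrite ffunE.
  by rewrite nth_cat size_tuple ltn_ord (unsplitK (inl i)).
by rewrite nth_cat size_tuple ltnNge leq_addr addKn (unsplitK (inr i)).
Qed.

Lemma int_span_sum (V : zmodType) (G : V -> Prop) I (s : seq I) (P : pred I)
    (F : I -> V) :
  (forall i, P i -> int_span G (F i)) -> int_span G (\sum_(i <- s | P i) F i)%R.
Proof. by move=> GF; apply: big_ind => //; [apply: int_span0|apply: int_spanD].
Qed.

Lemma mcoeff_sum_Perm n (P : pred 'S_n) (p : 'S_n) :
  ((\sum_(s | P s) << Defs.Perm s >> : PZ)@_(Defs.Perm p) = (P p)%:R)%R.
Proof.
rewrite raddf_sum /=; under eq_bigr do rewrite mcoeffU eq_Tagged /=.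
case Pp: (P p).
  by rewrite (bigD1 p) //= eqxx big1 ?addr0 // => s /andP[_ /negPf->].
by rewrite big1 // => s Ps; case: eqP => // sp; move: Pp; rewrite -sp Ps.
Qed.

Lemma mcoeff_sum_Perm0 m n (P : pred 'S_m) (p : 'S_n) : m != n ->
  ((\sum_(s | P s) << Defs.Perm s >> : PZ)@_(Defs.Perm p) = 0)%R.
Proof.
move=> mn; rewrite raddf_sum big1 // => s _; rewrite /= mcoeffU.
by case: eqP => // /(congr1 (@tag _ _)) /= e; rewrite e eqxx in mn.
Qed.

Lemma coplactic_mcoeff x n (p s : 'S_n) : coplactic x ->
  Qsymbol p = Qsymbol s -> (x@_(Defs.Perm p) = x@_(Defs.Perm s))%R.
Proof.
case=> m [X [GX [a ->]]] E; rewrite !raddf_sum /=; apply: eq_bigr => i _.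
rewrite !raddfMz; congr (_ *~ _)%R; rewrite -tnth_nth.
have [l [t ->]] := GX i; rewrite /coplactic_sum /=.
have [ln|ln] := eqVneq l n; last by rewrite !mcoeff_sum_Perm0.
by subst l; rewrite !mcoeff_sum_Perm E.
Qed.

Lemma Lie_coplactic_mcoeff x n (p s : 'S_n) : in_Lie x -> coplactic x ->
  Des p = Des s -> (x@_(Defs.Perm p) = x@_(Defs.Perm s))%R.
Proof.
move=> /(_ n) hLie hQ E;
  have cE (t : 'S_n) : (x@_(Defs.Perm t) = component n x t)%R.
  by rewrite ffunE.
rewrite !cE; case: n p s hLie E cE => [|n] p s; first by move=> /= ->;
  rewrite !ffunE.
case=> g eg E cE.
have fE t : component n.+1 x t = lie_sum g (word t) by rewrite eg gmul_omega.
have inv : shuffle_invariant 0 n.+1 (lie_sum g).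
  apply: coplactic_invariant => [t u Q|r q pe r0 q0].
    by rewrite -!fE -!cE; apply: coplactic_mcoeff.
  apply: shuf_lie_sum => // [|a].
    by rewrite (perm_uniq pe) iota_uniq.
  by rewrite (perm_mem pe) mem_iota.
have [k kP] := shuffle_invariant_des inv.
by rewrite !fE !kP ?word_perm // (Des_des E).
Qed.

Theorem theorem2 (x : PZ) (hLie : in_Lie x) (hQ : coplactic x) :
  in_descent_algebra x.
Proof.
(* All degrees in the support are below N, and [c n D] is the common coefficient of the permutations
   with descent set D, read off at any one of them. *)
pose N := \max_(p <- msupp x) (tag p).+1.
pose c n (D : {set 'I_n.-1}) : int :=
  if [pick p | Des p == D] is Some p then (x@_(Defs.Perm p))%R else 0%R.
have -> : x = (\sum_(n < N) \sum_(D : {set 'I_n.-1}) descent_sum D *~ c n D)%R.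
  apply/malgP => -[n p]; rewrite -/(Defs.Perm p) raddf_sum /=.
  have cD : c n (Des p) = (x@_(Defs.Perm p))%R.
    rewrite /c; case: pickP => [q /eqP qp|/(_ p)]; last by rewrite eqxx.
    exact: Lie_coplactic_mcoeff.
  have coef k : ((\sum_(D : {set 'I_k.-1}) descent_sum D *~ c k D)@_(Defs.Perm
    p) =
      if k == n then x@_(Defs.Perm p) else 0)%R.
    rewrite raddf_sum /=; case: eqP => [kn|/eqP kn]; last first.
      by rewrite big1 // => D _; rewrite raddfMz /= mcoeff_sum_Perm0 // mul0rz.
    subst k; rewrite (bigD1 (Des p)) //= big1 => [|D /negPf DD].
      by rewrite addr0 raddfMz /= mcoeff_sum_Perm eqxx cD intz.
    by rewrite raddfMz /= mcoeff_sum_Perm eq_sym DD mul0rz.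
  have [nN|Nn] := ltnP n N.
    rewrite (bigD1 (Ordinal nN)) //= coef eqxx big1 ?addr0 // => k kn.
    by rewrite coef ifN.
  rewrite big1 => [|k _];
    last by rewrite coef ifN // ltn_eqF // (leq_trans _ Nn).
  apply: mcoeff_outdom; apply/negP => px.
  have := @leq_bigmax_seq perms _ predT (fun q : perms => (tag q).+1) _ px isT.
  by move=> /= /leq_trans/(_ Nn); rewrite ltnn.
apply: int_span_sum => n _; apply: int_span_sum => D _; apply: int_spanMz.
by exists n, D.
Qed.
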